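(* For reducibilities $\leq_*$ and $\leq_{*'}$ between subsets of $\omega$, write $\leq_* \Longrightarrow \leq_{*'}$ if for all sets $A,B\subseteq\omega$, $A \leq_* B$ implies $A\leq_{*'} B$. (1) We have $$\leq_1 \;\Longrightarrow\; \leq_{\mathrm{mr}} \;\Longrightarrow\; \leq_T$$ and $$\leq_1 \;\Longrightarrow\; \leq_{\mathrm{mf}} \;\Longrightarrow\; \leq_{\mathrm{ubfb}} \;\Longrightarrow\; \leq_{\mathrm{cf}} \;\Longrightarrow\; \leq_T .$$ (2) No additional implications hold between any of the reducibilities $\leq_1,\leq_{\mathrm{mr}},\leq_{\mathrm{mf}},\leq_{\mathrm{ubfb}},\leq_{\mathrm{cf}},\leq_T$ (that is, the only implications among these six are those obtained from (1) by reflexivity and transitivity), or between them and $\leq_{\mathrm{g}}$, $\leq_{\mathrm{cor}}$, and $\leq_{\mathrm{ii}}$ (that is, if $\leq_*$ is one of these six and $\leq_{*'}$ is one of $\leq_{\mathrm{g}},\leq_{\mathrm{cor}},\leq_{\mathrm{ii}}$, then $\leq_*\,\not\Longrightarrow\,\leq_{*'}$ and $\leq_{*'}\,\not\Longrightarrow\,\leq_*$).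
   Context: Sets are subsets of $\omega$ and are identified with their characteristic functions. $\leq_T$ is Turing reducibility; $B\leq_1 A$ means $B=\{n: f(n)\in A\}$ for some computable one-to-one $f$. For partial functions $f,g$ on $\omega$, $f\simeq g$ means $f(n)=g(n)$ for every $n$ in both domains. A set $D\subseteq\omega$ has density $1$ if $\lim_{n}|D\cap n|/n=1$ (where $n=\{0,\dots,n-1\}$). Partial oracles. A partial oracle $(A)$ for a set $A$ is a set of triples $\langle n,x,l\rangle$ such that if $\langle n,0,l\rangle\in(A)$ for some $l$ then $n\notin A$, and if $\langle n,1,l\rangle\in(A)$ for some $l$ then $n\in A$. It is regarded as a partial function $(A):\omega\to\{0,1\}$ mapping $n$ to $x$ and taking $l$ steps to converge; its domain is the set of $n$ for which such $x,l$ exist. To query the $n$th bit of $(A)$ is to start a search for $x,l$ with $\langle n,x,l\rangle\in(A)$; while waiting, a computation may do other calculations and query other bits. A set $A$ is regarded as a partial oracle for itself that immediately halts on every input. Reducibilities. In each case $\Phi$ ranges over Turing functionals. - $B\leq_{\mathrm{mf}}A$ (mod-finite): there is $\Phi$ with $\Phi^A=B$ such that for any set $C$, if $\{n:C(n)=A(n)\}$ is cofinite then $\Phi^C$ is total and $\{n:\Phi^C(n)=B(n)\}$ is cofinite. - $B\leq_{\mathrm{cf}}A$ (cofinite): there is $\Phi$ with $\Phi^A=B$ such that for any partial oracle $(A)$ for $A$ with cofinite domain, $\Phi^{(A)}\simeq B$ and $\Phi^{(A)}$ has cofinite domain. - $B\leq_{\mathrm{g}}A$ (generic): there is $\Phi$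 such that for any partial oracle $(A)$ for $A$ with density-$1$ domain, $\Phi^{(A)}$ has density-$1$ domain and $\Phi^{(A)}\simeq B$. - $B\leq_{\mathrm{cor}}A$ (coarse): there is $\Phi$ such that for any set $C$, if $\{n:C(n)=A(n)\}$ has density $1$ then $\Phi^C$ is total and $\{n:\Phi^C(n)=B(n)\}$ has density $1$. - $B\leq_{\mathrm{mr}}A$ (mod-recursive): there is $\Phi$ with $\Phi^A=B$ such that for any set $C$, if $\{n:C(n)=A(n)\}$ is computable then $\Phi^C$ is total and $\{n:\Phi^C(n)=B(n)\}$ is computable. - $B\leq_{\mathrm{ii}}A$ (infinite-information): there is $\Phi$ such that for any partial oracle $(A)$ for $A$ with infinite domain, $\Phi^{(A)}\simeq B$ and $\Phi^{(A)}$ has infinite domain. - $B\leq_{\mathrm{ubfb}}A$ (use-bounded-from-below): there is $\Phi$ with $\Phi^A=B$ such that for every $m$ and all sufficiently large $n$, the functional does not query $A(m)$ in computing $\Phi^A(n)$ (the use is the set of bits actually queried, not an initial segment). *)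

(* Defs.v *)
From Stdlib Require Import Arith List Bool Reals ClassicalEpsilon Relations.
From Stdlib Require Cantor.
Import ListNotations.

Definition set := nat -> bool.

Definition chi (P : nat -> Prop) : set :=
  fun n => if excluded_middle_informative (P n) then true else false.

Definition finite (P : nat -> Prop) : Prop :=
  exists l : list nat, forall n, P n -> In n l.
Definition infinite (P : nat -> Prop) : Prop := ~ finite P.
Definition cofinite (P : nat -> Prop) : Prop := finite (fun n => ~ P n).

Definition card_below (P : nat -> Prop) (n : nat) : nat :=
  length (filter (chi P) (seq 0 n)).

(** The value at [n = 0] is a junk value and does not affect the limit. *)
Definition density1 (P : nat -> Prop) : Prop :=
  Un_cv (fun n => (INR (card_below P n) / INR n)%R) 1%R.

(** ** Turing functionals

    The partial recursive functionals, generated from the basic functions, the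
    oracle, pairing, composition, primitive recursion and unbounded search.
    All functions are unary; several arguments are coded by the bijective
    Cantor pairing. *)

Definition cpair (a b : nat) : nat := Cantor.to_nat (a, b).

Inductive functional : Type :=
| Zero
| Succ
| Left
| Right
| Oracle
| Pair (F G : functional)
| Comp (F G : functional)
| Prec (F G : functional)
| Mu (F : functional).

(** [run X F n y q]: with oracle [X], the functional [F] on input [n] halts with
    output [y], and [q] lists the oracle bits queried on the way.
    [Prec F G] maps [cpair a 0] to [F a], and [cpair a (S k)] to
    [G (cpair a (cpair k r))], where [r] is its value at [cpair a k].
    [Mu F] maps [cpair a m] to the least [k >= m] with [F (cpair a k) = 0],
    and diverges if some earlier value of [F] diverges. *)
Inductive run (X : set) : functional -> nat -> nat -> list nat -> Prop :=
| run_zero n : run X Zero n 0 []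
| run_succ n : run X Succ n (S n) []
| run_left a b : run X Left (cpair a b) a []
| run_right a b : run X Right (cpair a b) b []
| run_oracle n : run X Oracle n (Nat.b2n (X n)) [n]
| run_pair F G n a b q1 q2 :
    run X F n a q1 -> run X G n b q2 ->
    run X (Pair F G) n (cpair a b) (q1 ++ q2)
| run_comp F G n a b q1 q2 :
    run X G n a q1 -> run X F a b q2 ->
    run X (Comp F G) n b (q1 ++ q2)
| run_prec_O F G a b q :
    run X F a b q ->
    run X (Prec F G) (cpair a 0) b q
| run_prec_S F G a k r b q1 q2 :
    run X (Prec F G) (cpair a k) r q1 ->
    run X G (cpair a (cpair k r)) b q2 ->
    run X (Prec F G) (cpair a (S k)) b (q1 ++ q2)
| run_mu_found F a m q :
    run X F (cpair a m) 0 q ->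
    run X (Mu F) (cpair a m) m q
| run_mu_next F a m y r q1 q2 :
    run X F (cpair a m) (S y) q1 ->
    run X (Mu F) (cpair a (S m)) r q2 ->
    run X (Mu F) (cpair a m) r (q1 ++ q2).

Definition value (F : functional) (X : set) (n y : nat) : Prop :=
  exists q, run X F n y q.

Definition dom (F : functional) (X : set) (n : nat) : Prop :=
  exists y, value F X n y.

Definition total (F : functional) (X : set) : Prop := forall n, dom F X n.

Definition agrees_at (F : functional) (X B : set) (n : nat) : Prop :=
  value F X n (Nat.b2n (B n)).

(** [F^X = B] *)
Definition computes (F : functional) (X B : set) : Prop :=
  forall n, agrees_at F X B n.

(** [F^X] and [B] are equal wherever both are defined ([B] is total). *)
Definition compatible (F : functional) (X B : set) : Prop :=
  forall n y, value F X n y -> y = Nat.b2n (B n).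

Definition computable_fun (f : nat -> nat) : Prop :=
  exists F, forall n, value F (fun _ => false) n (f n).

Definition computable (P : nat -> Prop) : Prop :=
  computable_fun (fun n => Nat.b2n (chi P n)).

(** ** Partial oracles *)

(** A set of triples [(n, x, l)] with [x] in {0,1}. *)
Definition triples := nat -> bool -> nat -> bool.

Definition partial_oracle (A : set) (P : triples) : Prop :=
  forall n l, (P n false l = true -> A n = false) /\
              (P n true l = true -> A n = true).

Definition odom (P : triples) (n : nat) : Prop :=
  exists x l, P n x l = true.

(** The set of codes [cpair n (cpair x l)] of the triples. It is through this set
    that a functional accesses a partial oracle: querying the [n]th bit is
    searching for [x] and [l] whose triple belongs to it. *)
Definition coded (P : triples) : set := fun c =>
  let (n, c') := Cantor.of_nat c in
  let (x, l) := Cantor.of_nat c' in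
  match x with
  | 0 => P n false l
  | 1 => P n true l
  | _ => false
  end.

(** [A] as the partial oracle for itself that halts at once on every input. *)
Definition self_oracle (A : set) : triples :=
  fun n x l => Bool.eqb x (A n) && (l =? 0).

(** ** Reducibilities; in each of them, [B] is reduced to [A] *)

Definition le_1 (B A : set) : Prop :=
  exists f : nat -> nat, computable_fun f /\
    (forall m n, f m = f n -> m = n) /\
    (forall n, B n = A (f n)).

Definition le_T (B A : set) : Prop := exists F, computes F A B.

Definition le_mf (B A : set) : Prop :=
  exists F, computes F A B /\
    forall C : set, cofinite (fun n => C n = A n) ->
      total F C /\ cofinite (agrees_at F C B).

Definition le_cf (B A : set) : Prop :=
  exists F, computes F (coded (self_oracle A)) B /\
    forall P : triples, partial_oracle A P -> cofinite (odom P) ->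
      compatible F (coded P) B /\ cofinite (dom F (coded P)).

Definition le_g (B A : set) : Prop :=
  exists F, forall P : triples, partial_oracle A P -> density1 (odom P) ->
    density1 (dom F (coded P)) /\ compatible F (coded P) B.

Definition le_cor (B A : set) : Prop :=
  exists F, forall C : set, density1 (fun n => C n = A n) ->
    total F C /\ density1 (agrees_at F C B).

Definition le_mr (B A : set) : Prop :=
  exists F, computes F A B /\
    forall C : set, computable (fun n => C n = A n) ->
      total F C /\ computable (agrees_at F C B).

Definition le_ii (B A : set) : Prop :=
  exists F, forall P : triples, partial_oracle A P -> infinite (odom P) ->
    compatible F (coded P) B /\ infinite (dom F (coded P)).

Definition le_ubfb (B A : set) : Prop :=
  exists F, computes F A B /\
    forall m, exists N, forall n, N <= n ->
      forall y q, run A F n y q -> ~ In m q.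

Definition implies (R S : set -> set -> Prop) : Prop :=
  forall A B : set, R A B -> S A B.

Inductive base_red : Type := r_1 | r_mr | r_mf | r_ubfb | r_cf | r_T.
Inductive other_red : Type := r_g | r_cor | r_ii.

Definition base_le (r : base_red) : set -> set -> Prop :=
  match r with
  | r_1 => le_1
  | r_mr => le_mr
  | r_mf => le_mf
  | r_ubfb => le_ubfb
  | r_cf => le_cf
  | r_T => le_T
  end.

Definition other_le (s : other_red) : set -> set -> Prop :=
  match s with
  | r_g => le_g
  | r_cor => le_cor
  | r_ii => le_ii
  end.

Inductive arrow : base_red -> base_red -> Prop :=
| arrow_1_mr : arrow r_1 r_mr
| arrow_mr_T : arrow r_mr r_T
| arrow_1_mf : arrow r_1 r_mf
| arrow_mf_ubfb : arrow r_mf r_ubfb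
| arrow_ubfb_cf : arrow r_ubfb r_cf
| arrow_cf_T : arrow r_cf r_T.

(* Main.v *)
From Stdlib Require Import Arith List Bool Lia ClassicalEpsilon Relations Reals Lra.
From Stdlib Require Cantor.
Require Import Defs.
Import ListNotations.

(** From a mod-finite reduction one gets a use bounded from below by trying
    [m = n, n - 1, ...] and running the reduction on all the sets obtained from the oracle
    by overwriting its first [m] bits, until the results agree; the bits below [m] are then
    not needed. The other implications only translate oracles.

    The separations use sets that are generic for countably many open conditions:
    - mr, not cf: the parity of the first [n] bits of a generic set changes everywhere if
      one bit changes, but changes computably;
    - mf, not mr: complementing one factor of [A (n,0) && A (n,1)] on a computable set
      reveals the other factor;
    - ubfb, not mf: the search through the graph of a generic function need not be total
      on a finite variant, where a value is missing;
    - cf, not ubfb: every bit is given by an arbitrarily late row of the oracle, or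
      (in case it is [0]) also by a guard bit shared by infinitely many [n]; a reduction
      that stops asking for the guard could not tell an empty row from a late one.

    A set that is supported on the triangular numbers is trivial modulo density 0, but can
    have an arbitrary Turing degree. *)

(** * Cantor pairing, coded oracles and characteristic functions *)

Definition cfst (n : nat) : nat := fst (Cantor.of_nat n).
Definition csnd (n : nat) : nat := snd (Cantor.of_nat n).

Lemma cpair_eta n : cpair (cfst n) (csnd n) = n.
Proof.
  unfold cpair, cfst, csnd. rewrite <- surjective_pairing.
  apply Cantor.cancel_to_of.
Qed.

Lemma cfst_cpair a b : cfst (cpair a b) = a.
Proof. unfold cfst, cpair. now rewrite Cantor.cancel_of_to. Qed.

Lemma csnd_cpair a b : csnd (cpair a b) = b.
Proof. unfold csnd, cpair. now rewrite Cantor.cancel_of_to. Qed.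

Lemma cpair_inj a b c d : cpair a b = cpair c d -> a = c /\ b = d.
Proof.
  intros H; split.
  - rewrite <- (cfst_cpair a b), H; apply cfst_cpair.
  - rewrite <- (csnd_cpair a b), H; apply csnd_cpair.
Qed.

Lemma cpair_spec a b : 2 * cpair a b = 2 * b + (b + a) * S (b + a).
Proof.
  unfold cpair. generalize (Cantor.to_nat_spec a b). lia.
Qed.

Lemma cpair_mono a b c d : a <= c -> b <= d -> cpair a b <= cpair c d.
Proof.
  intros H1 H2. generalize (cpair_spec a b), (cpair_spec c d). nia.
Qed.

Lemma le_cpair_l a b : a <= cpair a b.
Proof. generalize (cpair_spec a b). nia. Qed.

Lemma le_cpair_r a b : b <= cpair a b.
Proof. generalize (cpair_spec a b). nia. Qed.

Lemma cfst_le n : cfst n <= n.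
Proof. rewrite <- (cpair_eta n) at 2. apply le_cpair_l. Qed.

Lemma csnd_le n : csnd n <= n.
Proof. rewrite <- (cpair_eta n) at 2. apply le_cpair_r. Qed.

Lemma coded_eq P n x l : coded P (cpair n (cpair x l)) =
  match x with 0 => P n false l | 1 => P n true l | _ => false end.
Proof. unfold coded, cpair. now rewrite !Cantor.cancel_of_to. Qed.

Lemma coded_cpair P n x l : coded P (cpair n (cpair (Nat.b2n x) l)) = P n x l.
Proof. rewrite coded_eq. now destruct x. Qed.

Global Opaque cpair cfst csnd.

Lemma chi_true (P : nat -> Prop) n : chi P n = true <-> P n.
Proof.
  unfold chi. destruct (excluded_middle_informative (P n)); intuition congruence.
Qed.

Lemma chi_ext (P Q : nat -> Prop) n : (P n <-> Q n) -> chi P n = chi Q n.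
Proof.
  intros H. unfold chi.
  destruct (excluded_middle_informative (P n)), (excluded_middle_informative (Q n)); tauto.
Qed.

Lemma b2n_inj a b : Nat.b2n a = Nat.b2n b -> a = b.
Proof. destruct a, b; simpl; congruence. Qed.

(** * Evaluation *)

Lemma run_use X Y F n y q :
  run X F n y q -> (forall c, In c q -> X c = Y c) -> run Y F n y q.
Proof.
  induction 1; intros E; try (econstructor; eauto using in_or_app; fail).
  rewrite E by (simpl; auto). constructor.
Qed.

(** The list of queries is replaced by a predicate that bounds them, so that uses compose without
    any bookkeeping of lists. With [Q] always true this is [value]. *)
Definition ev (X : set) (F : functional) (n y : nat) (Q : nat -> Prop) : Prop :=
  exists q, run X F n y q /\ forall c, In c q -> Q c.

Lemma value_ev F X n y : value F X n y <-> ev X F n y (fun _ => True).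
Proof. split; intros [q H]; exists q; tauto. Qed.

Lemma ev_value F X n y Q : ev X F n y Q -> value F X n y.
Proof. intros (q & H & _). now exists q. Qed.

Lemma ev_mono F X n y (Q Q' : nat -> Prop) :
  (forall c, Q c -> Q' c) -> ev X F n y Q -> ev X F n y Q'.
Proof. intros H (q & H1 & H2). exists q; auto. Qed.

Section Rules.
Variables (X : set) (Q : nat -> Prop).

Lemma ev_zero n : ev X Zero n 0 Q.
Proof. exists []; split; [constructor | easy]. Qed.

Lemma ev_succ n : ev X Succ n (S n) Q.
Proof. exists []; split; [constructor | easy]. Qed.

Lemma ev_left n : ev X Left n (cfst n) Q.
Proof.
  exists []; split; [| easy]. rewrite <- (cpair_eta n) at 1. constructor.
Qed.

Lemma ev_right n : ev X Right n (csnd n) Q.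
Proof.
  exists []; split; [| easy]. rewrite <- (cpair_eta n) at 1. constructor.
Qed.

Lemma ev_oracle n : Q n -> ev X Oracle n (Nat.b2n (X n)) Q.
Proof. exists [n]; split; [constructor | intros c [<- | []]; easy]. Qed.

Lemma ev_pair F G n a b :
  ev X F n a Q -> ev X G n b Q -> ev X (Pair F G) n (cpair a b) Q.
Proof.
  intros (q1 & R1 & H1) (q2 & R2 & H2). exists (q1 ++ q2); split.
  - now constructor.
  - intros c [?|?]%in_app_or; auto.
Qed.

Lemma ev_comp F G n a b :
  ev X G n a Q -> ev X F a b Q -> ev X (Comp F G) n b Q.
Proof.
  intros (q1 & R1 & H1) (q2 & R2 & H2). exists (q1 ++ q2); split.
  - econstructor; eauto.
  - intros c [?|?]%in_app_or; auto.
Qed.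

Lemma ev_prec_O F G a b : ev X F a b Q -> ev X (Prec F G) (cpair a 0) b Q.
Proof. intros (q & R & H). exists q; split; [now constructor | easy]. Qed.

Lemma ev_prec_S F G a k r b :
  ev X (Prec F G) (cpair a k) r Q -> ev X G (cpair a (cpair k r)) b Q ->
  ev X (Prec F G) (cpair a (S k)) b Q.
Proof.
  intros (q1 & R1 & H1) (q2 & R2 & H2). exists (q1 ++ q2); split.
  - econstructor; eauto.
  - intros c [?|?]%in_app_or; auto.
Qed.

Lemma ev_mu_found F a m : ev X F (cpair a m) 0 Q -> ev X (Mu F) (cpair a m) m Q.
Proof. intros (q & R & H). exists q; split; [now constructor | easy]. Qed.

Lemma ev_mu_next F a m y r :
  ev X F (cpair a m) (S y) Q -> ev X (Mu F) (cpair a (S m)) r Q ->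
  ev X (Mu F) (cpair a m) r Q.
Proof.
  intros (q1 & R1 & H1) (q2 & R2 & H2). exists (q1 ++ q2); split.
  - econstructor; eauto.
  - intros c [?|?]%in_app_or; auto.
Qed.

Lemma ev_prec F G a b (r : nat -> nat) :
  ev X F a (r 0) Q ->
  (forall k, k < b -> ev X G (cpair a (cpair k (r k))) (r (S k)) Q) ->
  ev X (Prec F G) (cpair a b) (r b) Q.
Proof.
  intros HF. induction b as [|b IH]; intros HG.
  - now apply ev_prec_O.
  - eapply ev_prec_S; eauto.
Qed.

Lemma ev_mu F a m k :
  m <= k -> (forall j, m <= j < k -> exists y, ev X F (cpair a j) (S y) Q) ->
  ev X F (cpair a k) 0 Q -> ev X (Mu F) (cpair a m) k Q.
Proof.
  intros Hm Hj H0. remember (k - m) as d eqn:Ed.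
  revert m Hm Hj Ed. induction d as [|d IH]; intros m Hm Hj Ed.
  - replace k with m in * by lia. now apply ev_mu_found.
  - destruct (Hj m) as (y & H); [lia |].
    eapply ev_mu_next; [exact H |].
    apply IH; [lia | intros; apply Hj; lia | lia].
Qed.

Lemma ev_comp_inv F G n y :
  ev X (Comp F G) n y Q -> exists a, ev X G n a Q /\ ev X F a y Q.
Proof.
  intros (q & R & H). inversion R; subst.
  exists a; split; [exists q1 | exists q2]; split; auto using in_or_app.
Qed.

End Rules.

(** * Inversion and determinism of runs *)

Lemma run_pair_inv X F G n y q : run X (Pair F G) n y q ->
  exists a b q1 q2, run X F n a q1 /\ run X G n b q2 /\ y = cpair a b /\ q = q1 ++ q2.
Proof. inversion 1; subst; eauto 10. Qed.

Lemma run_comp_inv X F G n y q : run X (Comp F G) n y q ->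
  exists a q1 q2, run X G n a q1 /\ run X F a y q2 /\ q = q1 ++ q2.
Proof. inversion 1; subst; eauto 10. Qed.

Lemma run_prec_O_inv X F G a y q :
  run X (Prec F G) (cpair a 0) y q -> run X F a y q.
Proof.
  (* The index [cpair a 0] is not a constructor form; the equation that inversion leaves is split by
     injectivity of the pairing. *)
  intros H. remember (cpair _ _) as c eqn:E. inversion H; subst;
  match goal with E : cpair _ _ = cpair _ _ |- _ => apply cpair_inj in E as [? E2] end;
    subst; easy.
Qed.

Lemma run_prec_S_inv X F G a k y q : run X (Prec F G) (cpair a (S k)) y q ->
  exists r q1 q2, run X (Prec F G) (cpair a k) r q1 /\
    run X G (cpair a (cpair k r)) y q2 /\ q = q1 ++ q2.
Proof.
  intros H. remember (cpair _ _) as c eqn:E. inversion H; subst;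
  match goal with E : cpair _ _ = cpair _ _ |- _ => apply cpair_inj in E as [? E2] end;
    [easy | injection E2 as ?; subst; eauto 10].
Qed.

Lemma run_mu_inv X F a m y q : run X (Mu F) (cpair a m) y q ->
  (y = m /\ run X F (cpair a m) 0 q) \/
  (exists z q1 q2, run X F (cpair a m) (S z) q1 /\
    run X (Mu F) (cpair a (S m)) y q2 /\ q = q1 ++ q2).
Proof.
  intros H. remember (cpair _ _) as c eqn:E. inversion H; subst;
  match goal with E : cpair _ _ = cpair _ _ |- _ => apply cpair_inj in E as [? E2] end;
    subst; [left | right]; eauto 10.
Qed.

Lemma run_det X F n y q : run X F n y q ->
  forall y' q', run X F n y' q' -> y = y' /\ q = q'.
Proof.
  induction 1; intros y' q' H'.
  - now inversion H'.
  - now inversion H'.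
  - remember (cpair _ _) as c eqn:E. inversion H'; subst.
    match goal with E : cpair _ _ = cpair _ _ |- _ => now apply cpair_inj in E end.
  - remember (cpair _ _) as c eqn:E. inversion H'; subst.
    match goal with E : cpair _ _ = cpair _ _ |- _ => now apply cpair_inj in E end.
  - now inversion H'.
  - apply run_pair_inv in H' as (? & ? & ? & ? & H1 & H2 & -> & ->).
    apply IHrun1 in H1 as [-> ->]. now apply IHrun2 in H2 as [-> ->].
  - apply run_comp_inv in H' as (? & ? & ? & H1 & H2 & ->).
    apply IHrun1 in H1 as [-> ->]. now apply IHrun2 in H2 as [-> ->].
  - apply run_prec_O_inv in H'. auto.
  - apply run_prec_S_inv in H' as (? & ? & ? & H1 & H2 & ->).
    apply IHrun1 in H1 as [-> ->]. now apply IHrun2 in H2 as [-> ->].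
  - apply run_mu_inv in H' as [[-> H1] | (? & ? & ? & H1 & _)].
    + now apply IHrun in H1.
    + now apply IHrun in H1.
  - apply run_mu_inv in H' as [[-> H1] | (? & ? & ? & H1 & H2 & ->)].
    + now apply IHrun1 in H1.
    + apply IHrun1 in H1 as [_ ->]. now apply IHrun2 in H2 as [-> ->].
Qed.

Lemma value_det X F n y y' : value F X n y -> value F X n y' -> y = y'.
Proof. intros [q H] [q' H']. exact (proj1 (run_det _ _ _ _ _ H _ _ H')). Qed.

Lemma value_left_inv X n y : value Left X n y -> y = cfst n.
Proof.
  intros H. eapply value_det; [exact H |]. eapply ev_value, (ev_left X (fun _ => True)).
Qed.

Lemma value_right_inv X n y : value Right X n y -> y = csnd n.
Proof.
  intros H. eapply value_det; [exact H |]. eapply ev_value, (ev_right X (fun _ => True)).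
Qed.

Lemma value_oracle_inv X n y : value Oracle X n y -> y = Nat.b2n (X n).
Proof. intros [q H]. now inversion H; subst. Qed.

Lemma value_pair_inv F G X n y :
  value (Pair F G) X n y -> exists a b, value F X n a /\ value G X n b /\ y = cpair a b.
Proof.
  intros [q (a & b & q1 & q2 & H)%run_pair_inv]. exists a, b. unfold value. firstorder.
Qed.

Lemma value_comp_inv F G X n y :
  value (Comp F G) X n y -> exists a, value G X n a /\ value F X a y.
Proof. intros [q (a & q1 & q2 & H)%run_comp_inv]. exists a. unfold value. firstorder. Qed.

Lemma value_prec_O_inv F G X a y : value (Prec F G) X (cpair a 0) y -> value F X a y.
Proof. intros [q H%run_prec_O_inv]. now exists q. Qed.

Lemma value_prec_S_inv F G X a k y : value (Prec F G) X (cpair a (S k)) y ->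
  exists r, value (Prec F G) X (cpair a k) r /\ value G X (cpair a (cpair k r)) y.
Proof. intros [q (r & q1 & q2 & H)%run_prec_S_inv]. exists r. unfold value. firstorder. Qed.

Lemma value_mu_inv F X a m y : value (Mu F) X (cpair a m) y ->
  (y = m /\ value F X (cpair a m) 0) \/
  (exists z, value F X (cpair a m) (S z) /\ value (Mu F) X (cpair a (S m)) y).
Proof.
  intros [q [[-> H] | (z & q1 & q2 & H1 & H2 & _)]%run_mu_inv]; unfold value; eauto 10.
Qed.

Lemma value_mu_zero F X n y : value (Mu F) X n y -> value F X (cpair (cfst n) y) 0.
Proof.
  intros [q H]. remember (Mu F) as M eqn:EM.
  induction H; try discriminate; injection EM as ->.
  - rewrite cfst_cpair. now exists q.
  - rewrite cfst_cpair in *. auto.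
Qed.

Definition Id : functional := Pair Left Right.

(** * Replacing the oracle by a functional *)

(** [subst G F] sends [cpair p n] to the value at [n] of [F] with the oracle
    [fun i => G (cpair p i)]. *)
Fixpoint subst (G F : functional) : functional :=
  match F with
  | Zero => Zero
  | Succ => Comp Succ Right
  | Left => Comp Left Right
  | Right => Comp Right Right
  | Oracle => G
  | Pair F1 F2 => Pair (subst G F1) (subst G F2)
  | Comp F1 F2 => Comp (subst G F1) (Pair Left (subst G F2))
  | Prec F1 F2 =>
      Comp (Prec (subst G F1)
                 (Comp (subst G F2) (Pair (Comp Left Left) (Pair (Comp Right Left) Right))))
           (Pair (Pair Left (Comp Left Right)) (Comp Right Right))
  | Mu F1 =>
      Comp (Mu (Comp (subst G F1) (Pair (Comp Left Left) (Pair (Comp Right Left) Right))))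
           (Pair (Pair Left (Comp Left Right)) (Comp Right Right))
  end.

Lemma ev_left_pair X Q a b : ev X Left (cpair a b) a Q.
Proof. rewrite <- (cfst_cpair a b) at 2. apply ev_left. Qed.

Lemma ev_right_pair X Q a b : ev X Right (cpair a b) b Q.
Proof. rewrite <- (csnd_cpair a b) at 2. apply ev_right. Qed.

Lemma ev_id X Q n : ev X Id n n Q.
Proof.
  unfold Id. rewrite <- (cpair_eta n) at 2. apply ev_pair; [apply ev_left | apply ev_right].
Qed.

Ltac evs := repeat first
  [ apply ev_left_pair | apply ev_right_pair | apply ev_zero | apply ev_succ
  | apply ev_id | apply ev_pair | eassumption
  | apply ev_left | apply ev_right
  | eapply ev_comp ].

Lemma ev_assoc X Q p a b :
  ev X (Pair (Pair Left (Comp Left Right)) (Comp Right Right))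
    (cpair p (cpair a b)) (cpair (cpair p a) b) Q.
Proof. evs. Qed.

Lemma ev_assoc' X Q p a b :
  ev X (Pair (Comp Left Left) (Pair (Comp Right Left) Right))
    (cpair (cpair p a) b) (cpair p (cpair a b)) Q.
Proof. evs. Qed.

Lemma assoc_inv X p a b c :
  value (Pair (Pair Left (Comp Left Right)) (Comp Right Right)) X
    (cpair p (cpair a b)) c -> c = cpair (cpair p a) b.
Proof.
  intros H. eapply value_det; [exact H |]. eapply ev_value, (ev_assoc X (fun _ => True)).
Qed.

Lemma assoc'_inv X p a b c :
  value (Pair (Comp Left Left) (Pair (Comp Right Left) Right)) X
    (cpair (cpair p a) b) c -> c = cpair p (cpair a b).
Proof.
  intros H. eapply value_det; [exact H |]. eapply ev_value, (ev_assoc' X (fun _ => True)).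
Qed.

(** Only the bits in the trace [q] have to be answered by [G], so [G] may diverge elsewhere. This is
    what partial oracles need. *)
Lemma ev_subst X Y G p Q F n y q :
  run Y F n y q ->
  (forall i, In i q -> ev X G (cpair p i) (Nat.b2n (Y i)) Q) ->
  ev X (subst G F) (cpair p n) y Q.
Proof.
  induction 1; intros HG; simpl.
  - apply ev_zero.
  - evs.
  - evs.
  - evs.
  - apply HG; simpl; auto.
  - apply ev_pair; eauto using in_or_app.
  - eapply ev_comp; [apply ev_pair; [apply ev_left_pair |] |]; eauto using in_or_app.
  - eapply ev_comp; [apply ev_assoc |]. apply ev_prec_O; auto.
  - specialize (IHrun1 ltac:(eauto using in_or_app)).
    specialize (IHrun2 ltac:(eauto using in_or_app)).
    simpl in IHrun1. apply ev_comp_inv in IHrun1 as (c & H1 & H2).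
    apply ev_value, assoc_inv in H1 as ->.
    eapply ev_comp; [apply ev_assoc |].
    eapply ev_prec_S; [exact H2 |]. eapply ev_comp; [apply ev_assoc' | exact IHrun2].
  - eapply ev_comp; [apply ev_assoc |].
    apply ev_mu_found.
    eapply ev_comp; [apply ev_assoc' | auto].
  - specialize (IHrun1 ltac:(eauto using in_or_app)).
    specialize (IHrun2 ltac:(eauto using in_or_app)).
    simpl in IHrun2. apply ev_comp_inv in IHrun2 as (c & H1 & H2).
    apply ev_value, assoc_inv in H1 as ->.
    eapply ev_comp; [apply ev_assoc |].
    eapply ev_mu_next; [eapply ev_comp; [apply ev_assoc' | exact IHrun1] | exact H2].
Qed.

(** The soundness counterpart of [ev_subst]: [G] may fail to answer but never answers wrongly, so a
    halting simulation can only retrace the run with the true oracle [Y]. *)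
Lemma value_subst_compat X Y G p F n y y' :
  (forall i z, value G X (cpair p i) z -> z = Nat.b2n (Y i)) ->
  value F Y n y' -> value (subst G F) X (cpair p n) y -> y = y'.
Proof.
  intros HG [q H]; revert y.
  induction H; intros y0 H'; simpl in H'.
  - destruct H' as [q' H']; now inversion H'.
  - apply value_comp_inv in H' as (a & H1 & [q' H2]).
    apply value_right_inv in H1. rewrite csnd_cpair in H1. subst. now inversion H2.
  - apply value_comp_inv in H' as (c & H1 & H2).
    apply value_right_inv in H1. apply value_left_inv in H2. subst.
    now rewrite csnd_cpair, cfst_cpair.
  - apply value_comp_inv in H' as (c & H1 & H2).
    apply value_right_inv in H1. apply value_right_inv in H2. subst.
    now rewrite !csnd_cpair.
  - auto.
  - apply value_pair_inv in H' as (a' & b' & H1 & H2 & ->). f_equal; auto.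
  - apply value_comp_inv in H' as (c & H1 & H2).
    apply value_pair_inv in H1 as (p' & a' & H3 & H4 & ->).
    apply value_left_inv in H3. rewrite cfst_cpair in H3. subst.
    apply IHrun1 in H4 as ->. auto.
  - apply value_comp_inv in H' as (c & H1 & H2).
    apply assoc_inv in H1 as ->. apply value_prec_O_inv in H2. auto.
  - apply value_comp_inv in H' as (c & H1 & H2).
    apply assoc_inv in H1 as ->. apply value_prec_S_inv in H2 as (r' & H3 & H4).
    assert (r' = r) as ->.
    { apply IHrun1. simpl. apply value_ev. eapply ev_comp; [apply ev_assoc |].
      now apply value_ev. }
    apply value_comp_inv in H4 as (d & H5 & H6).
    apply assoc'_inv in H5 as ->. auto.
  - apply value_comp_inv in H' as (c & H1 & H2).
    apply assoc_inv in H1 as ->. apply value_mu_inv in H2 as [[-> _] | (z & H3 & _)]; [easy |].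
    apply value_comp_inv in H3 as (d & H5 & H6). apply assoc'_inv in H5 as ->.
    now apply IHrun in H6.
  - apply value_comp_inv in H' as (c & H1 & H2).
    apply assoc_inv in H1 as ->. apply value_mu_inv in H2 as [[-> H3] | (z & H3 & H4)].
    + apply value_comp_inv in H3 as (d & H5 & H6). apply assoc'_inv in H5 as ->.
      now apply IHrun1 in H6.
    + apply IHrun2. simpl. apply value_ev. eapply ev_comp; [apply ev_assoc |].
      now apply value_ev.
Qed.

(** * Arithmetic *)

Definition is_zero (n : nat) : nat := match n with 0 => 1 | S _ => 0 end.

Definition IsZero : functional :=
  Comp (Prec (Comp Succ Zero) Zero) (Pair Zero Id).

Lemma ev_is_zero X Q n : ev X IsZero n (is_zero n) Q.
Proof.
  unfold IsZero. eapply ev_comp; [apply ev_pair; [apply ev_zero | apply ev_id] |].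
  apply ev_prec; intros; evs.
Qed.

(** A conditional: [cpair a b] goes to [a] if [b] is nonzero, and to 0 otherwise. On bits it is
    conjunction. *)
Definition When : functional := Prec Zero Left.

Lemma ev_when X Q a b :
  ev X When (cpair a b) (match b with 0 => 0 | S _ => a end) Q.
Proof.
  apply (ev_prec X Q _ _ a b (fun b => match b with 0 => 0 | S _ => a end));
    intros; evs.
Qed.

Definition Pred : functional := Comp (Prec Zero (Comp Left Right)) (Pair Zero Id).

Lemma ev_pred X Q n : ev X Pred n (pred n) Q.
Proof.
  unfold Pred. eapply ev_comp; [apply ev_pair; [apply ev_zero | apply ev_id] |].
  apply ev_prec; intros; evs.
Qed.

Definition Sub : functional := Prec Id (Comp Pred (Comp Right Right)).

Lemma ev_sub X Q a b : ev X Sub (cpair a b) (a - b) Q.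
Proof.
  apply (ev_prec X Q _ _ a b (fun k => a - k)).
  - rewrite Nat.sub_0_r. apply ev_id.
  - intros k _. replace (a - S k) with (pred (a - k)) by lia.
    eapply ev_comp; [evs | apply ev_pred].
Qed.

Definition Add : functional := Prec Id (Comp Succ (Comp Right Right)).

Lemma ev_add X Q a b : ev X Add (cpair a b) (a + b) Q.
Proof.
  apply (ev_prec X Q _ _ a b (fun k => a + k)).
  - rewrite Nat.add_0_r. apply ev_id.
  - intros k _. rewrite Nat.add_succ_r. evs.
Qed.

Fixpoint Const (k : nat) : functional :=
  match k with 0 => Zero | S k => Comp Succ (Const k) end.

Lemma ev_const X Q k n : ev X (Const k) n k Q.
Proof. induction k; simpl; evs. Qed.

Fixpoint sum_below (w : nat -> nat) (b : nat) : nat :=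
  match b with 0 => 0 | S b => sum_below w b + w b end.

Lemma sum_below_zero w b : sum_below w b = 0 <-> (forall c, c < b -> w c = 0).
Proof.
  induction b as [|b IH]; simpl; [split; lia |].
  rewrite Nat.eq_add_0, IH. split.
  - intros [H1 H2] c Hc. destruct (Nat.eq_dec c b) as [-> |]; [easy | apply H1; lia].
  - intros H; split; intros; apply H; lia.
Qed.

(** Bounded quantification: the sum vanishes iff all values below the bound do. *)
Definition Sum (W : functional) : functional :=
  Prec Zero (Comp Add (Pair (Comp Right Right) (Comp W (Pair Left (Comp Left Right))))).

Lemma ev_sum X Q W a b w :
  (forall c, c < b -> ev X W (cpair a c) (w c) Q) ->
  ev X (Sum W) (cpair a b) (sum_below w b) Q.
Proof.
  intros H. apply ev_prec; [apply ev_zero |]. intros k Hk. simpl.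
  eapply ev_comp; [| apply ev_add]. apply ev_pair; [evs |].
  eapply ev_comp; [evs | auto].
Qed.

(** * The implications *)

(** Substituting the constant 0 for the oracle leaves a functional that makes no queries, so its
    value is the same for all [X] and its use satisfies every [Q]. *)
Lemma computable_fun_functional f :
  computable_fun f -> exists F, forall X Q n, ev X F n (f n) Q.
Proof.
  intros [F HF]. exists (Comp (subst Zero F) (Pair Zero Id)). intros X Q n.
  destruct (HF n) as [q R].
  eapply ev_comp; [evs |]. eapply ev_subst; [exact R |]. intros; apply ev_zero.
Qed.

Lemma computable_of_ev F f :
  (forall n, ev (fun _ => false) F n (f n) (fun _ => True)) -> computable_fun f.
Proof. intros H. exists F. intros n. apply value_ev, H. Qed.

Lemma agrees_at_iff F X B n y :
  value F X n (Nat.b2n y) -> (agrees_at F X B n <-> y = B n).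
Proof.
  intros H. unfold agrees_at. split.
  - intros H'. apply b2n_inj, (value_det _ _ _ _ _ H H').
  - now intros <-.
Qed.

Lemma computable_ext (P P' : nat -> Prop) :
  (forall n, P n <-> P' n) -> computable P -> computable P'.
Proof.
  intros H [F HF]. exists F. intros n. now rewrite <- (chi_ext _ _ n (H n)).
Qed.

Lemma finite_le (P : nat -> Prop) N : (forall n, P n -> n <= N) -> finite P.
Proof. intros H. exists (seq 0 (S N)). intros n Hn%H. apply in_seq. lia. Qed.

Lemma finite_bound (P : nat -> Prop) : finite P -> exists N, forall n, P n -> n <= N.
Proof.
  intros [l Hl]. exists (list_max l). intros n Hn%Hl.
  pose proof (proj1 (list_max_le l (list_max l)) (le_n _)) as H.
  rewrite Forall_forall in H. auto.
Qed.

Lemma cofinite_bound (P : nat -> Prop) : cofinite P -> exists N, forall n, N <= n -> P n.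
Proof.
  intros [N HN]%finite_bound. exists (S N). intros n Hn.
  apply NNPP. intros H%HN. lia.
Qed.

Lemma cofinite_ge (P : nat -> Prop) N : (forall n, N <= n -> P n) -> cofinite P.
Proof.
  intros H. apply (finite_le _ N). intros n Hn.
  destruct (le_lt_dec N n); [now elim Hn; apply H | lia].
Qed.

(** The results agree at [n] iff the oracles agree at [f n], so the agreement set is a computable
    preimage of a computable set. *)
Lemma le_1_mr : implies le_1 le_mr.
Proof.
  intros B A (f & Hf & _ & HB).
  destruct (computable_fun_functional _ Hf) as [F HF].
  assert (HC : forall C n, value (Comp Oracle F) C n (Nat.b2n (C (f n)))).
  { intros C n. apply value_ev. eapply ev_comp; [apply HF | now apply ev_oracle]. }
  exists (Comp Oracle F). split.
  - intros n. unfold agrees_at. rewrite HB. apply HC.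
  - intros C [G HG]. split; [intros n; eexists; apply HC |].
    apply (computable_ext (fun n => C (f n) = A (f n))).
    { intros n. rewrite (agrees_at_iff _ _ _ _ _ (HC C n)), HB. reflexivity. }
    exists (Comp G F). intros n. apply value_ev.
    eapply ev_comp; [apply HF |].
    change (chi (fun n => C (f n) = A (f n)) n) with (chi (fun n => C n = A n) (f n)).
    apply value_ev, HG.
Qed.

Lemma injective_preimage_finite (f : nat -> nat) P :
  (forall m n, f m = f n -> m = n) -> finite P -> finite (fun n => P (f n)).
Proof.
  intros Hf [l Hl].
  exists (flat_map (fun c => match excluded_middle_informative (exists n, f n = c) with
                     | left E => [proj1_sig (constructive_indefinite_description _ E)]
                     | right _ => [] end) l).
  intros n Hn. apply in_flat_map. exists (f n); split; [auto |].
  destruct (excluded_middle_informative _) as [E | []]; [| now exists n].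
  destruct (constructive_indefinite_description _ E) as [m Hm]. left. simpl. auto.
Qed.

Lemma le_1_mf : implies le_1 le_mf.
Proof.
  intros B A (f & Hf & Hinj & HB).
  destruct (computable_fun_functional _ Hf) as [F HF].
  assert (HC : forall C n, value (Comp Oracle F) C n (Nat.b2n (C (f n)))).
  { intros C n. apply value_ev. eapply ev_comp; [apply HF | now apply ev_oracle]. }
  exists (Comp Oracle F). split.
  - intros n. unfold agrees_at. rewrite HB. apply HC.
  - intros C Hfin. split; [intros n; eexists; apply HC |].
    apply (injective_preimage_finite f) in Hfin; [| exact Hinj].
    destruct Hfin as [l Hl]. exists l. intros n Hn. apply Hl. intros E. apply Hn.
    rewrite (agrees_at_iff _ _ _ _ _ (HC C n)), HB. exact E.
Qed.

Lemma le_mr_T : implies le_mr le_T.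
Proof. intros B A (F & HF & _). now exists F. Qed.

(** ** From mod-finite to use-bounded-from-below *)

(** Every number codes an infinite bit sequence: it is read as an iterated pair, and a component
    counts as bit 1 iff it is 0. *)
Definition code_bit (c i : nat) : nat := is_zero (cfst (Nat.iter i csnd c)).

Definition CodeBit : functional :=
  Comp IsZero (Comp Left (Prec Id (Comp Right (Comp Right Right)))).

Lemma ev_code_bit X Q c i : ev X CodeBit (cpair c i) (code_bit c i) Q.
Proof.
  unfold CodeBit, code_bit. eapply ev_comp; [| apply ev_is_zero].
  eapply ev_comp; [| apply ev_left].
  apply (ev_prec X Q _ _ c i (fun k => Nat.iter k csnd c)); [apply ev_id |].
  intros k _. simpl. evs.
Qed.

Definition patch (A : set) (m c : nat) : set := fun i =>
  if i <? m then code_bit c i =? 1 else A i.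

(** On input [cpair (cpair m c) i]; the oracle is queried only if [m <= i]. *)
Definition Patch : functional :=
  Comp (Prec (Comp CodeBit (Pair (Comp Right Left) Right)) (Comp Oracle (Comp Right Left)))
       (Pair Id (Comp Sub (Pair (Comp Succ Right) (Comp Left Left)))).

Lemma ev_patch X m c i :
  ev X Patch (cpair (cpair m c) i) (Nat.b2n (patch X m c i)) (fun j => m <= j).
Proof.
  unfold Patch. eapply ev_comp.
  { apply ev_pair; [apply ev_id |]. eapply ev_comp; [| apply ev_sub]. evs. }
  unfold patch. destruct (Nat.ltb_spec i m) as [H | H].
  - replace (S i - m) with 0 by lia. apply ev_prec_O.
    replace (Nat.b2n (code_bit c i =? 1)) with (code_bit c i)
      by (unfold code_bit, is_zero; now destruct (cfst _)).
    eapply ev_comp; [| apply ev_code_bit]. evs.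
  - replace (S i - m) with (S (i - m)) by lia.
    change (Nat.b2n (X i)) with
      ((fun t => match t with 0 => code_bit c i | S _ => Nat.b2n (X i) end) (S (i - m))).
    apply ev_prec.
    + eapply ev_comp; [| apply ev_code_bit]. evs.
    + intros k _. eapply ev_comp; [evs | now apply ev_oracle].
Qed.

(** Components 0 and 1 suffice to code a string, so by monotonicity of the pairing all strings of
    length [m] have codes below this bound. Repeated strings do no harm. *)
Fixpoint code_bound (m : nat) : nat :=
  match m with 0 => 1 | S m => S (cpair 1 (code_bound m)) end.

Lemma code_exists (A : set) m :
  exists c, c < code_bound m /\ forall i, i < m -> code_bit c i = Nat.b2n (A i).
Proof.
  revert A. induction m as [|m IH]; intros A; simpl; [exists 0; split; lia |].
  destruct (IH (fun i => A (S i))) as (c & Hc & H).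
  exists (cpair (if A 0 then 0 else 1) c). split.
  - apply Nat.lt_succ_r, cpair_mono; [destruct (A 0) |]; lia.
  - intros [|i] Hi; unfold code_bit.
    + simpl. rewrite cfst_cpair. now destruct (A 0).
    + rewrite Nat.iter_succ_r, csnd_cpair. apply H. lia.
Qed.

Definition CodeBound : functional :=
  Comp (Prec (Const 1) (Comp Succ (Pair (Const 1) (Comp Right Right)))) (Pair Zero Id).

Lemma ev_code_bound X Q m : ev X CodeBound m (code_bound m) Q.
Proof.
  unfold CodeBound. eapply ev_comp; [evs |].
  apply ev_prec; [apply ev_const |]. intros k _.
  eapply ev_comp; [| apply ev_succ]. apply ev_pair; [apply ev_const | evs].
Qed.

Lemma patch_cofinite A m c : cofinite (fun n => patch A m c n = A n).
Proof.
  apply (cofinite_ge _ m). intros n Hn. unfold patch.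
  now rewrite (proj2 (Nat.ltb_ge n m) Hn).
Qed.

Lemma le_mf_ubfb : implies le_mf le_ubfb.
Proof.
  intros B A (F & HF & Hmf).
  pose (v m n c := epsilon (inhabits 0) (value F (patch A m c) n)).
  assert (Hv : forall m n c, value F (patch A m c) n (v m n c)).
  { intros m n c. apply epsilon_spec. now apply Hmf, patch_cofinite. }
  assert (Htrue : forall m n, exists c, c < code_bound m /\ v m n c = Nat.b2n (B n)).
  { intros m n. destruct (code_exists A m) as (c & Hc & H). exists c; split; [easy |].
    eapply value_det; [apply Hv |]. destruct (HF n) as [q R]. exists q.
    eapply run_use; [exact R |]. intros i _. unfold patch.
    destruct (Nat.ltb_spec i m); [| easy]. rewrite H by easy. now destruct (A i). }
  pose (V := Comp (subst Patch F) (Pair (Pair (Comp Right Left) Right) (Comp Left Left))).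
  assert (HV : forall n m c, ev A V (cpair (cpair n m) c) (v m n c) (fun j => m <= j)).
  { intros n m c. eapply ev_comp; [evs |]. destruct (Hv m n c) as [q R].
    eapply ev_subst; [exact R |]. intros. apply ev_patch. }
  (* [some m n = 0] says that all overwritten oracles give 0 at [n], and [none m n = 0] that none of
     them does. Either one is the unanimity called [good] below. *)
  pose (some m n := sum_below (v m n) (code_bound m)).
  pose (none m n := sum_below (fun c => is_zero (v m n c)) (code_bound m)).
  pose (SumS := Comp (Sum V) (Pair Id (Comp CodeBound Right))).
  pose (SumN := Comp (Sum (Comp IsZero V)) (Pair Id (Comp CodeBound Right))).
  assert (HS : forall n m, ev A SumS (cpair n m) (some m n) (fun j => m <= j)).
  { intros n m. unfold SumS. eapply ev_comp.
    - apply ev_pair; [apply ev_id | eapply ev_comp; [apply ev_right_pair | apply ev_code_bound]].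
    - apply ev_sum. auto. }
  assert (HN : forall n m, ev A SumN (cpair n m) (none m n) (fun j => m <= j)).
  { intros n m. unfold SumN. eapply ev_comp.
    - apply ev_pair; [apply ev_id | eapply ev_comp; [apply ev_right_pair | apply ev_code_bound]].
    - apply (ev_sum _ _ _ _ _ (fun c => is_zero (v m n c))). intros.
      eapply ev_comp; [apply HV | apply ev_is_zero]. }
  (* The search variable [j] stands for the level [m = n - j], so that minimization runs downwards
     from [m = n]. *)
  pose (Level := Pair Left Sub).
  pose (Test := Comp When (Comp (Pair SumS SumN) Level)).
  pose (Out := Comp IsZero (Comp IsZero
    (Comp SumS (Comp Level (Pair Id (Comp (Mu Test) (Pair Id Zero))))))).
  assert (Hlevel : forall n j Q, ev A Level (cpair n j) (cpair n (n - j)) Q).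
  { intros. apply ev_pair; [apply ev_left_pair | apply ev_sub]. }
  pose (good m n := some m n = 0 \/ none m n = 0).
  assert (Htest : forall n j, ev A Test (cpair n j)
    (match none (n - j) n with 0 => 0 | S _ => some (n - j) n end) (fun i => n - j <= i)).
  { intros n j. eapply ev_comp; [eapply ev_comp; [apply Hlevel |] | apply ev_when].
    apply ev_pair; auto. }
  (* One of the codes is that of the true initial segment of [A], so a unanimous answer is correct
     at whatever level it occurs. *)
  assert (Hsound : forall m n, good m n -> is_zero (is_zero (some m n)) = Nat.b2n (B n)).
  { intros m n [H | H]; destruct (Htrue m n) as (c & Hc & E).
    - rewrite H. rewrite (proj1 (sum_below_zero _ _) H c Hc) in E. exact E.
    - assert (Hpos : v m n c <> 0).
      { intros E0. apply (proj1 (sum_below_zero _ _) H) in Hc. now rewrite E0 in Hc. }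
      destruct (some m n) as [|s] eqn:Es.
      + apply (proj1 (sum_below_zero _ _) Es) in Hc. contradiction.
      + simpl. destruct (B n); [easy |]. now rewrite E in Hpos. }
  assert (Hrun : forall n m0, m0 <= n -> good m0 n ->
    ev A Out n (Nat.b2n (B n)) (fun i => m0 <= i)).
  { intros n m0 Hm Hg.
    destruct (dec_inh_nat_subset_has_unique_least_element (fun j => good (n - j) n))
      as (j & [Hj Hleast] & _).
    { intros j. unfold good. lia. }
    { exists (n - m0). now replace (n - (n - m0)) with m0 by lia. }
    assert (Hj0 : j <= n - m0).
    { apply Hleast. now replace (n - (n - m0)) with m0 by lia. }
    apply (ev_mono _ _ _ _ (fun i => n - j <= i)); [lia |].
    unfold Out. eapply ev_comp; [| rewrite <- (Hsound _ _ Hj); apply ev_is_zero].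
    eapply ev_comp; [| apply ev_is_zero].
    eapply ev_comp; [| apply HS]. eapply ev_comp; [| apply Hlevel].
    apply ev_pair; [apply ev_id |]. eapply ev_comp; [evs |].
    apply ev_mu; [lia | |].
    - intros i [_ Hi].
      assert (Hn : ~ good (n - i) n) by (intros H%Hleast; lia).
      unfold good in Hn.
      exists (pred (some (n - i) n)). eapply (ev_mono _ _ _ _ (fun c => n - i <= c)); [lia |].
      replace (S _) with (some (n - i) n) by lia.
      generalize (Htest n i). destruct (none (n - i) n); [lia | easy].
    - generalize (Htest n j). destruct Hj as [H | H]; rewrite H; [now destruct (none _ _) | easy]. }
  (* There are finitely many codes below the bound, and each overwritten oracle gives the right
     answer at almost all [n]. *)
  assert (Hgood : forall m, exists N, forall n, N <= n -> good m n).
  { intros m.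
    assert (H : forall b, exists N, forall n, N <= n -> forall c, c < b -> v m n c = Nat.b2n (B n)).
    { induction b as [|b [N HN']]; [exists 0; lia |].
      destruct (cofinite_bound _ (proj2 (Hmf _ (patch_cofinite A m b)))) as [N' HN''].
      exists (max N N'). intros n Hn c Hc.
      destruct (Nat.eq_dec c b) as [-> |]; [| apply HN'; lia].
      eapply value_det; [apply Hv | apply HN''; lia]. }
    destruct (H (code_bound m)) as [N HN']. exists N. intros n Hn.
    unfold good, some, none. rewrite !sum_below_zero.
    destruct (B n) eqn:EB; [right | left]; intros c Hc; rewrite HN', EB; easy. }
  exists Out. split.
  (* At level 0 there is only the code 0, as [code_bound 0 = 1], so unanimity is trivial and the
     search always ends. *)
  - intros n. destruct (Hrun n 0) as (q & R & _); [lia | | now exists q].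
    unfold good, some, none. rewrite !sum_below_zero. simpl.
    destruct (v 0 n 0) eqn:E; [left | right];
      intros c Hc; replace c with 0 by lia; now rewrite E.
  - intros m. destruct (Hgood (S m)) as [N HN']. exists (max N (S m)).
    intros n Hn y q R Hin.
    destruct (Hrun n (S m)) as (q' & R' & Hq'); [lia | apply HN'; lia |].
    assert (q' = q) as -> by (eapply run_det; eassumption).
    apply Hq' in Hin. lia.
Qed.

(** ** From use-bounded-from-below to cofinite *)

(** Finds the least [w] with [cpair i w] in the oracle. In a coded partial oracle [w] is
    [cpair x l], and its first component is the bit at [i]. *)
Definition Search : functional :=
  Comp Left (Comp (Mu (Comp IsZero Oracle)) (Pair Id Zero)).

Lemma ev_search X i w : X (cpair i w) = true ->
  exists w', X (cpair i w') = true /\ ev X Search i (cfst w') (fun c => cfst c = i).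
Proof.
  intros Hw.
  destruct (dec_inh_nat_subset_has_unique_least_element (fun w => X (cpair i w) = true))
    as (w' & [Hw' Hleast] & _).
  { intros j. destruct (X (cpair i j)); auto. }
  { now exists w. }
  exists w'; split; [easy |]. unfold Search.
  assert (H : forall j, ev X (Comp IsZero Oracle) (cpair i j)
    (is_zero (Nat.b2n (X (cpair i j)))) (fun c => cfst c = i)).
  { intros j. eapply ev_comp; [apply ev_oracle, cfst_cpair | apply ev_is_zero]. }
  eapply ev_comp; [| apply ev_left]. eapply ev_comp; [evs |].
  apply ev_mu; [lia | |].
  - intros j Hj. exists 0. generalize (H j). destruct (X (cpair i j)) eqn:E; [| easy].
    apply Hleast in E. lia.
  - generalize (H w'). now rewrite Hw'.
Qed.

Lemma value_search_inv X i y :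
  value Search X i y -> exists w, X (cpair i w) = true /\ y = cfst w.
Proof.
  intros (w & (p & Hp & Hmu)%value_comp_inv & ->%value_left_inv)%value_comp_inv.
  exists w; split; [| easy].
  apply value_mu_zero in Hmu.
  assert (p = cpair i 0) as ->.
  { eapply value_det; [exact Hp |]. apply value_ev. evs. }
  rewrite cfst_cpair in Hmu.
  apply value_comp_inv in Hmu as (z & Hz & H0). apply value_oracle_inv in Hz as ->.
  destruct (X (cpair i w)); [easy |].
  assert (H1 : value IsZero X (Nat.b2n false) 1) by apply value_ev, ev_is_zero.
  now apply (value_det _ _ _ _ _ H0) in H1.
Qed.

Lemma coded_true P c : coded P c = true ->
  exists n x l, c = cpair n (cpair (Nat.b2n x) l) /\ P n x l = true.
Proof.
  rewrite <- (cpair_eta c), <- (cpair_eta (csnd c)).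
  set (n := cfst c). set (x := cfst (csnd c)). set (l := csnd (csnd c)).
  intros H. exists n.
  destruct x as [|[|x]].
  - exists false, l. now rewrite <- coded_cpair.
  - exists true, l. now rewrite <- coded_cpair.
  - now rewrite coded_eq in H.
Qed.

Lemma value_search_oracle A P i y :
  partial_oracle A P -> value Search (coded P) i y -> y = Nat.b2n (A i).
Proof.
  intros HP (w & (n & x & l & E & H)%coded_true & ->)%value_search_inv.
  apply cpair_inj in E as [-> ->]. rewrite cfst_cpair. f_equal.
  destruct (HP n l) as [H0 H1]. destruct x; symmetry; auto.
Qed.

Lemma ev_search_oracle A P i :
  partial_oracle A P -> odom P i ->
  ev (coded P) Search i (Nat.b2n (A i)) (fun c => cfst c = i).
Proof.
  intros HP (x & l & H). rewrite <- coded_cpair in H.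
  apply ev_search in H as (w & _ & Hw).
  now rewrite <- (value_search_oracle A P i _ HP (ev_value _ _ _ _ _ Hw)).
Qed.

Lemma partial_oracle_self A : partial_oracle A (self_oracle A).
Proof.
  intros n l. unfold self_oracle. destruct (A n); simpl; split; congruence.
Qed.

Lemma odom_self A n : odom (self_oracle A) n.
Proof. exists (A n), 0. unfold self_oracle. now rewrite eqb_reflx. Qed.

(** Each oracle query becomes a search. The simulation is never wrong, and it halts if all queried
    bits lie in the domain of the partial oracle; the finitely many missing bits are queried for
    only finitely many [n]. *)
Lemma le_ubfb_cf : implies le_ubfb le_cf.
Proof.
  intros B A (F & HF & Hu).
  pose (G := Comp Search Right).
  pose (F' := Comp (subst G F) (Pair Zero Id)).
  assert (Hhalt : forall P n y q, partial_oracle A P -> run A F n y q ->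
    (forall i, In i q -> odom P i) -> value F' (coded P) n y).
  { intros P n y q HP R Hq. apply value_ev. eapply ev_comp; [evs |].
    eapply ev_subst; [exact R |]. intros i Hi. eapply ev_comp; [apply ev_right_pair |].
    eapply ev_mono; [| eapply ev_search_oracle; eauto]. easy. }
  exists F'. split.
  - intros n. destruct (HF n) as [q R].
    eapply Hhalt; [apply partial_oracle_self | exact R | intros; apply odom_self].
  - intros P HP Hcof. split.
    + intros n y (p & Hp & Hy)%value_comp_inv.
      assert (p = cpair 0 n) as ->.
      { eapply value_det; [exact Hp |]. apply value_ev. evs. }
      eapply value_subst_compat; [| apply HF | exact Hy].
      intros i z (i' & Hi & Hz)%value_comp_inv.
      apply value_right_inv in Hi as ->. rewrite csnd_cpair in Hz.
      eapply value_search_oracle; eauto.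
    + destruct (cofinite_bound _ Hcof) as [N HN].
      (* One bound that serves all the finitely many [m < N]. *)
      assert (H : exists N', forall n, N' <= n -> forall m, m < N ->
        forall y q, run A F n y q -> ~ In m q).
      { clear HN. induction N as [|N [N' IH]]; [exists 0; lia |].
        destruct (Hu N) as [N'' HN'']. exists (max N' N''). intros n Hn m Hm.
        destruct (Nat.eq_dec m N) as [-> |]; [apply HN'' | apply IH]; lia. }
      destruct H as [N' HN']. apply (cofinite_ge _ N'). intros n Hn.
      destruct (HF n) as [q R]. eexists. eapply Hhalt; [exact HP | exact R |].
      intros i Hi. apply HN. destruct (le_lt_dec N i); [easy |].
      elim (HN' n Hn i l (Nat.b2n (B n)) q R Hi).
Qed.

Lemma le_cf_T : implies le_cf le_T.
Proof.
  intros B A (F & HF & _).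
  (* A code [cpair n (cpair x l)] lies in the oracle iff
     [(x - A n) + (A n - x) + l = 0]. *)
  pose (Bit := Comp Oracle Left).
  pose (Val := Comp Left Right).
  pose (G := Comp IsZero (Comp Add (Pair
         (Comp Add (Pair (Comp Sub (Pair Val Bit)) (Comp Sub (Pair Bit Val))))
         (Comp Right Right)))).
  assert (HG : forall c, ev A G c (Nat.b2n (coded (self_oracle A) c)) (fun _ => True)).
  { intros c. rewrite <- (cpair_eta c), <- (cpair_eta (csnd c)).
    set (n := cfst c). set (x := cfst (csnd c)). set (l := csnd (csnd c)).
    set (a := Nat.b2n (A n)).
    replace (Nat.b2n _) with (is_zero (x - a + (a - x) + l)).
    - assert (HB : ev A Bit (cpair n (cpair x l)) a (fun _ => True)).
      { eapply ev_comp; [apply ev_left_pair | now apply ev_oracle]. }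
      assert (HV : ev A Val (cpair n (cpair x l)) x (fun _ => True)) by evs.
      eapply ev_comp; [| apply ev_is_zero]. eapply ev_comp; [| apply ev_add].
      apply ev_pair; [| evs]. eapply ev_comp; [| apply ev_add].
      apply ev_pair; (eapply ev_comp; [| apply ev_sub]); evs.
    - rewrite coded_eq. unfold self_oracle, a.
      destruct x as [|[|x]]; destruct (A n); destruct l; reflexivity. }
  exists (Comp (subst (Comp G Right) F) (Pair Zero Id)).
  intros n. destruct (HF n) as [q R]. apply value_ev. eapply ev_comp; [evs |].
  eapply ev_subst; [exact R |]. intros i _.
  eapply ev_comp; [apply ev_right_pair | apply HG].
Qed.

(** * Generic points *)

Definition agree {T : Type} (k : nat) (g g' : nat -> T) : Prop :=
  forall n, n < k -> g n = g' n.

(** Open in the product topology, with [T] discrete. *)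
Definition open {T : Type} (U : (nat -> T) -> Prop) : Prop :=
  forall g, U g -> exists k, forall g', agree k g g' -> U g'.

Definition countable (I : Type) : Prop :=
  exists code : I -> nat, forall x y, code x = code y -> x = y.

Lemma agree_refl {T} k (g : nat -> T) : agree k g g.
Proof. easy. Qed.

Lemma agree_trans {T} k (g g' g'' : nat -> T) :
  agree k g g' -> agree k g' g'' -> agree k g g''.
Proof. intros H H' n Hn. rewrite H; auto. Qed.

Lemma agree_le {T} k k' (g g' : nat -> T) : k <= k' -> agree k' g g' -> agree k g g'.
Proof. intros Hk H n Hn. apply H. lia. Qed.

Section Generic.
Variables (T I : Type) (t0 : T).
(** [W k n t] allows the value [t] at [n] once the values below [k] are fixed. *)
Variable W : nat -> nat -> T -> Prop.
Hypothesis W_default : forall k n, W k n t0.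
Hypothesis W_antitone : forall k k' n t, k <= k' -> W k' n t -> W k n t.
Variable U : I -> (nat -> T) -> Prop.
Hypothesis U_open : forall i, open (U i).
Hypothesis I_countable : countable I.

(** A forcing condition consists of the first [k] values of [g] together with the restriction [W k]
    on all later values; [g'] is a point that meets it. *)
Definition admissible (k : nat) (g g' : nat -> T) : Prop :=
  agree k g g' /\ forall n, k <= n -> W k n (g' n).

(** Every condition can be extended to one that forces [V], unless [V] already fails at all points
    meeting the condition. In the latter case one goes on with default values. *)
Lemma admissible_step (V : (nat -> T) -> Prop) g k : open V ->
  exists g' k', admissible k g g' /\ k < k' /\
    ((forall g'', agree k' g' g'' -> V g'') \/ forall g', admissible k g g' -> ~ V g').
Proof.
  intros HV.
  destruct (classic (exists g', admissible k g g' /\ V g')) as [(g' & Hg' & H) | H].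
  - destruct (HV _ H) as [k' Hk']. exists g', (S (max k k')).
    split; [easy | split; [lia | left]].
    intros g'' H''. apply Hk'. eapply agree_le; [| exact H'']. lia.
  - exists (fun n => if n <? k then g n else t0), (S k). split; [split | split; [lia | right]].
    + intros n Hn. now rewrite (proj2 (Nat.ltb_lt n k) Hn).
    + intros n Hn. now rewrite (proj2 (Nat.ltb_ge n k) Hn).
    + intros g' Hg' HVg'. apply H. now exists g'.
Qed.

Lemma generic_exists : exists g,
  (forall m, exists k, m <= k /\ admissible k g g) /\
  forall i, exists k, admissible k g g /\
    (U i g \/ forall g', admissible k g g' -> ~ U i g').
Proof.
  destruct I_countable as [code code_inj].
  (* Stage [s] treats the open set with code [s], or the empty set if there is none. *)
  pose (V s g := exists i, code i = s /\ U i g).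
  assert (HV : forall s, open (V s)).
  { intros s g (i & E & H). destruct (U_open i g H) as [k Hk].
    exists k. intros g' Hg'. exists i. auto. }
  pose (R s (p p' : (nat -> T) * nat) := admissible (snd p) (fst p) (fst p') /\ snd p < snd p' /\
    ((forall g'', agree (snd p') (fst p') g'' -> V s g'') \/
     forall g', admissible (snd p) (fst p) g' -> ~ V s g')).
  assert (HR : forall s p, exists p', R s p p').
  { intros s [g k]. destruct (admissible_step (V s) g k (HV s)) as (g' & k' & H).
    now exists (g', k'). }
  pose (step s p := proj1_sig (constructive_indefinite_description _ (HR s p))).
  assert (Hstep : forall s p, R s p (step s p)).
  { intros s p. unfold step. now destruct (constructive_indefinite_description _ _). }
  pose (st := fix st s := match s with 0 => (fun _ => t0, 0) | S s => step s (st s) end).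
  pose (G s := fst (st s)). pose (K s := snd (st s)).
  assert (HK : forall s, K s < K (S s)) by (intros s; apply (Hstep s (st s))).
  assert (HKle : forall s s', s <= s' -> K s <= K s').
  { induction 1; [easy |]. specialize (HK m). lia. }
  assert (HKge : forall s, s <= K s).
  { induction s; [lia | specialize (HK s); lia]. }
  assert (HG : forall s s', s <= s' -> agree (K s) (G s) (G s')).
  { intros s s' Hs. induction Hs as [| s' Hs IH]; [easy |].
    eapply agree_trans; [exact IH |].
    eapply agree_le; [apply HKle, Hs | apply (Hstep s' (st s'))]. }
  (* As [s <= K s], the value at [n] is final from stage [S n] on. *)
  pose (g n := G (S n) n).
  assert (Hg : forall s, agree (K s) (G s) g).
  { intros s n Hn. unfold g. destruct (le_ge_dec s (S n)) as [H | H].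
    - apply HG; easy.
    - symmetry. apply (HG (S n) s H). specialize (HKge (S n)). lia. }
  assert (HW : forall s n, K s <= n -> W (K s) n (g n)).
  { intros s n Hn.
    (* The value at [n] is settled at a stage [s + d] with [K (s + d) <= n < K (S (s + d))], under
       the restriction of that stage, which is at least as strict as that of stage [s]. *)
    assert (H : forall d, K s <= n -> n < K (s + d) -> W (K s) n (g n)).
    { clear Hn. induction d as [|d IH]; intros H1 H2.
      - rewrite Nat.add_0_r in H2. lia.
      - destruct (le_lt_dec (K (s + d)) n) as [H | H]; [| auto].
        rewrite Nat.add_succ_r in H2.
        rewrite <- (Hg (S (s + d)) n H2).
        eapply W_antitone; [| apply (Hstep (s + d) (st (s + d))); exact H].
        apply HKle. lia. }
    apply (H (S n)); [easy |]. specialize (HKge (s + S n)). lia. }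
  assert (Hadm : forall s, admissible (K s) g g) by (intros s; split; [easy | apply HW]).
  exists g; split.
  - intros m. exists (K m). auto.
  - intros i. exists (K (code i)). split; [auto |].
    destruct (Hstep (code i) (st (code i))) as (_ & _ & [H | H]).
    + left. destruct (H g (Hg (S (code i)))) as (j & E & Hj).
      apply code_inj in E. now subst.
    + right. intros g' [Hg' HWg'] HU. apply (H g').
      * split; [| exact HWg']. eapply agree_trans; [apply Hg | exact Hg'].
      * now exists i.
Qed.

End Generic.

Lemma cohen_generic_exists {T I : Type} (t0 : T) (U : I -> (nat -> T) -> Prop) :
  (forall i, open (U i)) -> countable I ->
  exists g, forall i, U i g \/ exists k, forall g', agree k g g' -> ~ U i g'.
Proof.
  intros HU HI.
  destruct (generic_exists T I t0 (fun _ _ _ => True)) with (U := U) as (g & _ & H); auto.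
  exists g. intros i. destruct (H i) as (k & _ & [H' | H']); [now left | right].
  exists k. intros g' Hg'. now apply H'.
Qed.

(** * Countable index sets and continuous maps *)

Fixpoint functional_code (F : functional) : nat :=
  match F with
  | Zero => cpair 0 0
  | Succ => cpair 1 0
  | Left => cpair 2 0
  | Right => cpair 3 0
  | Oracle => cpair 4 0
  | Pair F G => cpair 5 (cpair (functional_code F) (functional_code G))
  | Comp F G => cpair 6 (cpair (functional_code F) (functional_code G))
  | Prec F G => cpair 7 (cpair (functional_code F) (functional_code G))
  | Mu F => cpair 8 (functional_code F)
  end.

Lemma countable_functional : countable functional.
Proof.
  exists functional_code.
  intros F; induction F; intros [] H; simpl in H; try reflexivity;
    apply cpair_inj in H as [H1 H2]; try discriminate;
    try (apply cpair_inj in H2 as [H2 H3]); f_equal; auto.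
Qed.

Lemma countable_nat : countable nat.
Proof. exists (fun n => n). auto. Qed.

Lemma countable_prod I J : countable I -> countable J -> countable (I * J).
Proof.
  intros [c Hc] [d Hd]. exists (fun p => cpair (c (fst p)) (d (snd p))).
  intros [x y] [x' y'] [H1 H2]%cpair_inj. f_equal; auto.
Qed.

Lemma countable_sum I J : countable I -> countable J -> countable (I + J).
Proof.
  intros [c Hc] [d Hd].
  exists (fun p => match p with inl x => cpair 0 (c x) | inr y => cpair 1 (d y) end).
  intros [x | y] [x' | y'] [H1 H2]%cpair_inj; try discriminate; f_equal; auto.
Qed.

Definition continuous {T : Type} (A : (nat -> T) -> set) : Prop :=
  forall c g, exists k, forall g', agree k g g' -> A g c = A g' c.

Lemma continuous_list {T} (A : (nat -> T) -> set) g q : continuous A ->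
  exists k, forall g', agree k g g' -> forall c, In c q -> A g c = A g' c.
Proof.
  intros HA. induction q as [|c q [k Hk]]; [now exists 0 |].
  destruct (HA c g) as [k' Hk']. exists (max k k'). intros g' Hg' c' [<- | Hc'].
  - apply Hk'. eapply agree_le; [| exact Hg']. lia.
  - apply Hk; [eapply agree_le; [| exact Hg']; lia | easy].
Qed.

Lemma continuous_run {T} (A : (nat -> T) -> set) F g n y q :
  continuous A -> run (A g) F n y q ->
  exists k, forall g', agree k g g' -> run (A g') F n y q.
Proof.
  intros HA R. destruct (continuous_list A g q HA) as [k Hk].
  exists k. intros g' Hg'. eapply run_use; [exact R | auto].
Qed.

(** A wrong output is witnessed by a finite computation. Hence if a generic point has no conflict
    with [F], then neither has any point that meets some condition on it. *)
Lemma open_conflict {T} (A B : (nat -> T) -> set) F :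
  continuous A -> continuous B ->
  open (fun g => exists n y, value F (A g) n y /\ y <> Nat.b2n (B g n)).
Proof.
  intros HA HB g (n & y & [q R] & Hy).
  destruct (continuous_run A F g n y q HA R) as [k Hk].
  destruct (HB n g) as [k' Hk'].
  exists (max k k'). intros g' Hg'. exists n, y. split.
  - exists q. apply Hk. eapply agree_le; [| exact Hg']. lia.
  - rewrite <- (Hk' g'); [easy |]. eapply agree_le; [| exact Hg']. lia.
Qed.

Lemma continuous_id : continuous (fun g : set => g).
Proof. intros c g. exists (S c). intros g' H. apply H. lia. Qed.

Lemma agree_upd {T} k (g : nat -> T) t : agree k g (fun n => if n =? k then t else g n).
Proof. intros n Hn. now rewrite (proj2 (Nat.eqb_neq n k)) by lia. Qed.

(** * Mod-recursive does not imply cofinite *)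

Fixpoint parity (X : set) (n : nat) : bool :=
  match n with 0 => false | S n => xorb (parity X n) (X n) end.

Lemma parity_xorb X Y n :
  parity (fun i => xorb (X i) (Y i)) n = xorb (parity X n) (parity Y n).
Proof.
  induction n as [|n IH]; simpl; [easy |]. rewrite IH.
  now destruct (parity X n), (parity Y n), (X n), (Y n).
Qed.

Lemma parity_agree n X Y : agree n X Y -> parity X n = parity Y n.
Proof.
  induction n as [|n IH]; intros H; simpl; [easy |].
  rewrite IH by (eapply agree_le; [| exact H]; lia). now rewrite H by lia.
Qed.

Definition Xor : functional := Comp Add (Pair Sub (Comp Sub (Pair Right Left))).

Lemma ev_xor X Q a b :
  ev X Xor (cpair (Nat.b2n a) (Nat.b2n b)) (Nat.b2n (xorb a b)) Q.
Proof.
  replace (Nat.b2n (xorb a b)) with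
    ((Nat.b2n a - Nat.b2n b) + (Nat.b2n b - Nat.b2n a)) by now destruct a, b.
  eapply ev_comp; [| apply ev_add]. apply ev_pair; [apply ev_sub |].
  eapply ev_comp; [| apply ev_sub]. evs.
Qed.

Definition Parity : functional :=
  Comp (Prec Zero (Comp Xor (Pair (Comp Right Right) (Comp Oracle (Comp Left Right)))))
       (Pair Zero Succ).

Lemma value_parity X n : value Parity X n (Nat.b2n (parity X (S n))).
Proof.
  apply value_ev. eapply ev_comp; [evs |].
  apply (ev_prec X _ _ _ 0 (S n) (fun k => Nat.b2n (parity X k))); [apply ev_zero |].
  intros k _. eapply ev_comp; [| apply ev_xor].
  apply ev_pair; [evs |]. eapply ev_comp; [evs | now apply ev_oracle].
Qed.

Lemma oracle_trans X Y G F : (forall i, value G X i (Nat.b2n (Y i))) ->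
  exists F', forall n y, value F Y n y -> value F' X n y.
Proof.
  intros HG. exists (Comp (subst (Comp G Right) F) (Pair Zero Id)).
  intros n y [q R]. apply value_ev. eapply ev_comp; [evs |].
  eapply ev_subst; [exact R |]. intros i _.
  eapply ev_comp; [apply ev_right_pair | now apply value_ev].
Qed.

(** Parity is additive: the results differ at [n] iff the parity of the symmetric difference of [C]
    and [A] is odd there, and that difference is computable. *)
Lemma parity_mr A : le_mr (fun n => parity A (S n)) A.
Proof.
  exists Parity. split; [intros n; apply value_parity |].
  intros C [G HG]. split; [intros n; eexists; apply value_parity |].
  destruct (oracle_trans (fun _ => false) (fun i => xorb (C i) (A i)) (Comp IsZero G) Parity)
    as [F HF].
  { intros i. apply value_ev. eapply ev_comp; [apply value_ev, HG |].
    replace (Nat.b2n (xorb (C i) (A i))) with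
      (is_zero (Nat.b2n (chi (fun n => C n = A n) i))); [apply ev_is_zero |].
    unfold chi. destruct (excluded_middle_informative _) as [-> | H].
    - now rewrite xorb_nilpotent.
    - now destruct (C i), (A i). }
  exists (Comp IsZero F). intros n. apply value_ev.
  eapply ev_comp; [apply value_ev, HF, value_parity |].
  rewrite parity_xorb.
  rewrite (chi_ext _ (fun n => parity C (S n) = parity A (S n)) n
    (agrees_at_iff _ _ _ _ _ (value_parity C n))).
  match goal with |- ev _ _ _ ?v _ => replace v with
    (is_zero (Nat.b2n (xorb (parity C (S n)) (parity A (S n))))); [apply ev_is_zero |] end.
  unfold chi. destruct (excluded_middle_informative _) as [-> | H].
  - now rewrite xorb_nilpotent.
  - now destruct (parity C (S n)), (parity A (S n)).
Qed.

Definition tail_oracle (k : nat) (A : set) : triples :=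
  fun n x l => (k <? n) && self_oracle A n x l.

Lemma partial_oracle_tail k A : partial_oracle A (tail_oracle k A).
Proof.
  intros n l. destruct (partial_oracle_self A n l) as [H0 H1].
  unfold tail_oracle. destruct (k <? n); simpl; split; auto; discriminate.
Qed.

Lemma odom_tail k A n : k < n -> odom (tail_oracle k A) n.
Proof.
  intros H%Nat.ltb_lt. destruct (odom_self A n) as (x & l & E).
  exists x, l. unfold tail_oracle. now rewrite H.
Qed.

Lemma coded_ext P P' c : (forall x l, P (cfst c) x l = P' (cfst c) x l) ->
  coded P c = coded P' c.
Proof.
  intros H. rewrite <- (cpair_eta c) at 1 2. rewrite <- (cpair_eta (csnd c)), !coded_eq.
  destruct (cfst (csnd c)) as [|[|]]; auto.
Qed.

Lemma continuous_tail k : continuous (fun A => coded (tail_oracle k A)).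
Proof.
  intros c g. exists (S c). intros g' H. apply coded_ext. intros x l.
  unfold tail_oracle, self_oracle. rewrite (H (cfst c)); [easy |].
  specialize (cfst_le c). lia.
Qed.

Lemma le_mr_not_cf : ~ implies le_mr le_cf.
Proof.
  intros Himp.
  pose (U F (g : set) := exists k n y,
    value F (coded (tail_oracle k g)) n y /\ y <> Nat.b2n (parity g (S n))).
  destruct (cohen_generic_exists false U) as [A HA].
  - intros F g (k & H).
    destruct (open_conflict (fun g => coded (tail_oracle k g))
      (fun g n => parity g (S n)) F) with (g := g) as [k' Hk'];
      [apply continuous_tail | | exact H |].
    + intros n g0. exists (S n). intros g1 H01. now apply parity_agree.
    + exists k'. intros g' Hg'. exists k. now apply Hk'.
  - apply countable_functional.
  - destruct (Himp _ _ (parity_mr A)) as (F & _ & HF).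
    assert (Htail : forall k, compatible F (coded (tail_oracle k A)) (fun n => parity A (S n)) /\
      cofinite (dom F (coded (tail_oracle k A)))).
    { intros k. apply HF; [apply partial_oracle_tail |].
      apply (cofinite_ge _ (S k)). intros m Hm. now apply odom_tail. }
    destruct (HA F) as [(k & n & y & Hv & Hy) | [k Hk]].
    + elim Hy. now apply (proj1 (Htail k)).
    + destruct (Htail k) as [Hc [N HN]%cofinite_bound].
      destruct (HN (max N k)) as [y Hy]; [lia |].
      (* Bit [k] is hidden from [tail_oracle k], so flipping it preserves the computation but
         reverses the parity at every [n >= k]. The flipped set still meets the condition, which
         excludes conflicts. *)
      pose (n := max N k). pose (A' := fun i => if i =? k then negb (A i) else A i).
      apply (Hk A').
      * intros i Hi. unfold A'. now rewrite (proj2 (Nat.eqb_neq i k)) by lia.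
      * exists k, n, y. split.
        -- destruct Hy as [q R]. exists q. eapply run_use; [exact R |].
           intros c _. apply coded_ext. intros x l. unfold tail_oracle.
           destruct (Nat.ltb_spec k (cfst c)); [| easy]. simpl.
           unfold self_oracle, A'. now rewrite (proj2 (Nat.eqb_neq _ k)) by lia.
        -- rewrite (Hc n y Hy).
           assert (Hflip : forall m, parity A' m = xorb (k <? m) (parity A m)).
           { induction m as [|m IH]; [easy |]. simpl. rewrite IH. unfold A'.
             destruct (Nat.eqb_spec m k) as [-> |].
             - rewrite Nat.ltb_irrefl, (proj2 (Nat.ltb_lt k (S k))) by lia.
               now destruct (parity A k), (A k).
             - replace (k <? S m) with (k <? m); [now rewrite xorb_assoc |].
               destruct (Nat.ltb_spec k m), (Nat.ltb_spec k (S m)); lia. }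
           rewrite Hflip, (proj2 (Nat.ltb_lt k (S n))) by lia.
           now destruct (parity A (S n)).
Qed.

(** * Mod-finite does not imply mod-recursive *)

Definition row_and (A : set) : set := fun n => A (cpair n 0) && A (cpair n 1).

Definition RowAnd : functional :=
  Comp When (Pair (Comp Oracle (Pair Id Zero)) (Comp Oracle (Pair Id (Const 1)))).

Lemma value_row_and X n : value RowAnd X n (Nat.b2n (row_and X n)).
Proof.
  apply value_ev. unfold row_and.
  replace (Nat.b2n (X (cpair n 0) && X (cpair n 1))) with
    (match Nat.b2n (X (cpair n 1)) with 0 => 0 | S _ => Nat.b2n (X (cpair n 0)) end)
    by now destruct (X (cpair n 0)), (X (cpair n 1)).
  eapply ev_comp; [| apply ev_when].
  apply ev_pair; (eapply ev_comp; [| now apply ev_oracle]).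
  - evs.
  - apply ev_pair; [apply ev_id | apply ev_const].
Qed.

Lemma row_and_mf A : le_mf (row_and A) A.
Proof.
  exists RowAnd. split; [intros n; apply value_row_and |].
  intros C [N HN]%cofinite_bound. split; [intros n; eexists; apply value_row_and |].
  apply (cofinite_ge _ N). intros n Hn.
  apply (agrees_at_iff _ _ _ _ _ (value_row_and C n)). unfold row_and.
  now rewrite !HN by (eapply Nat.le_trans; [exact Hn | apply le_cpair_l]).
Qed.

Lemma le_mf_not_mr : ~ implies le_mf le_mr.
Proof.
  intros Himp.
  (* The first family is met by wrong outputs. The second says that an oracle-free computation
     predicts a second factor at some [n >= k]. *)
  pose (U i (g : set) := match i with
    | inl F => exists n y, value F g n y /\ y <> Nat.b2n (row_and g n)
    | inr (F, k) => exists n, k <= n /\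
        value F (fun _ => false) n (Nat.b2n (g (cpair n 1))) end).
  destruct (cohen_generic_exists false U) as [A HA].
  - intros [F | [F k]].
    + apply (open_conflict (fun g => g) row_and); [apply continuous_id |].
      intros n g. exists (S (cpair n 1)). intros g' H. unfold row_and.
      rewrite !H; [easy | lia |].
      assert (cpair n 0 <= cpair n 1) by (apply cpair_mono; lia). lia.
    + intros g (n & Hn & Hv). exists (S (cpair n 1)). intros g' H.
      exists n. rewrite <- H by lia. auto.
  - apply countable_sum; [| apply countable_prod];
      auto using countable_functional, countable_nat.
  - destruct (Himp _ _ (row_and_mf A)) as (F & HF & Hmr).
    destruct (HA (inl F)) as [(n & y & Hv & Hy) | [k Hk]].
    { elim Hy. eapply value_det; [exact Hv | apply HF]. }
    (* Truncated subtraction tests [k <= cfst c]. The first factors are complemented from [k] on;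
       since [cfst c <= c], the bits below [k] stay and [F] cannot err on [C]. *)
    pose (R c := (k - cfst c =? 0) && (csnd c =? 0)).
    pose (C c := xorb (R c) (A c)).
    destruct (Hmr C) as [Htot [G HG]].
    { exists (Comp IsZero (Comp When (Pair (Comp IsZero (Comp Sub (Pair (Const k) Left)))
                                           (Comp IsZero Right)))).
      intros c. apply value_ev.
      replace (Nat.b2n (chi _ c)) with
        (is_zero (match is_zero (csnd c) with 0 => 0 | S _ => is_zero (k - cfst c) end)).
      - eapply ev_comp; [| apply ev_is_zero]. eapply ev_comp; [| apply ev_when].
        apply ev_pair; (eapply ev_comp; [| apply ev_is_zero]); [| apply ev_right].
        eapply ev_comp; [| apply ev_sub]. apply ev_pair; [apply ev_const | apply ev_left].
      - rewrite (chi_ext _ (fun c => R c = false)).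
        + unfold chi, R. destruct (excluded_middle_informative _) as [E | E];
            destruct (k - cfst c), (csnd c); simpl in *; congruence.
        + unfold C. destruct (R c), (A c); simpl; split; congruence. }
    assert (HC : forall n, value F C n (Nat.b2n (row_and C n))).
    { intros n. destruct (Htot n) as [y Hy].
      destruct (Nat.eq_dec y (Nat.b2n (row_and C n))) as [<- | Hne]; [easy |].
      elim (Hk C); [| now exists n, y].
      intros c Hc. unfold C, R.
      destruct (k - cfst c) eqn:E; [| easy]. specialize (cfst_le c). lia. }
    assert (HCA : forall n, k <= n -> row_and C n = row_and A n <-> A (cpair n 1) = false).
    { intros n Hn. unfold row_and, C, R.
      rewrite !cfst_cpair, !csnd_cpair. replace (k - n) with 0 by lia. simpl.
      destruct (A (cpair n 0)), (A (cpair n 1)); simpl; split; congruence. }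
    assert (HGA : forall n, k <= n ->
      value G (fun _ => false) n (Nat.b2n (negb (A (cpair n 1))))).
    { intros n Hn. specialize (HG n).
      rewrite (chi_ext _ (fun n => A (cpair n 1) = false)) in HG.
      - unfold chi in HG. destruct (excluded_middle_informative _) as [E | E]; [now rewrite E |].
        now destruct (A (cpair n 1)).
      - rewrite <- HCA by easy. now apply agrees_at_iff. }
    destruct (HA (inr (G, k))) as [(n & Hn & Hv) | [k' Hk']].
    + pose proof (value_det _ _ _ _ _ Hv (HGA n Hn)) as E.
      now destruct (A (cpair n 1)).
    (* Flipping this second factor turns the wrong prediction of [G] into a correct one, beyond the
       condition that excludes correct predictions. *)
    + pose (n := max k k').
      apply (Hk' (fun i => if i =? cpair n 1 then negb (A i) else A i)).
      * intros i Hi. rewrite (proj2 (Nat.eqb_neq _ _)); [easy |].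
        specialize (le_cpair_l n 1). lia.
      * exists n. split; [lia |]. rewrite Nat.eqb_refl. apply HGA. lia.
Qed.

(** * Use-bounded-from-below does not imply mod-finite *)

(** The graph of [h] as a partial oracle: bit [n] is [snd (h n)] and appears only at time
    [fst (h n)]. *)
Definition graph_oracle (h : nat -> nat * bool) : triples :=
  fun n x l => (l =? fst (h n)) && Bool.eqb x (snd (h n)).

Lemma graph_oracle_true h n x l : graph_oracle h n x l = true <-> h n = (l, x).
Proof.
  unfold graph_oracle. rewrite andb_true_iff, Nat.eqb_eq, eqb_true_iff.
  destruct (h n). simpl. split; [intros [-> ->] | injection 1 as -> ->]; easy.
Qed.

Lemma ev_search_graph h n :
  ev (coded (graph_oracle h)) Search n (Nat.b2n (snd (h n))) (fun c => cfst c = n).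
Proof.
  apply (ev_search_oracle (fun n => snd (h n))).
  - intros i l. rewrite !graph_oracle_true. split; intros ->; easy.
  - exists (snd (h n)), (fst (h n)). apply graph_oracle_true, surjective_pairing.
Qed.

(** The search for [n] asks only for codes with first component [n], so a given [m] is queried for
    at most one [n]. *)
Lemma graph_ubfb h : le_ubfb (fun n => snd (h n)) (coded (graph_oracle h)).
Proof.
  exists Search. split.
  - intros n. eapply ev_value, ev_search_graph.
  - intros m. exists (S (cfst m)). intros n Hn y q R Hm.
    destruct (ev_search_graph h n) as (q' & R' & Hq').
    destruct (run_det _ _ _ _ _ R _ _ R') as [_ <-].
    apply Hq' in Hm. lia.
Qed.

Lemma in_list_max c q : In c q -> c <= list_max q.
Proof.
  intros Hc. pose proof (proj1 (list_max_le q (list_max q)) (le_n _)) as H.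
  rewrite Forall_forall in H. auto.
Qed.

Lemma le_ubfb_not_mf : ~ implies le_ubfb le_mf.
Proof.
  intros Himp.
  pose (U F (h : nat -> nat * bool) := exists n y,
    value F (coded (graph_oracle h)) n y /\ y <> Nat.b2n (snd (h n))).
  destruct (cohen_generic_exists (0, false) U) as [h Hh].
  - intros F. apply (open_conflict (fun h => coded (graph_oracle h)) (fun h n => snd (h n))).
    + intros c g. exists (S c). intros g' H. apply coded_ext. intros x l.
      unfold graph_oracle. rewrite (H (cfst c)); [easy |]. specialize (cfst_le c). lia.
    + intros c g. exists (S c). intros g' H. now rewrite H by lia.
  - apply countable_functional.
  - destruct (Himp _ _ (graph_ubfb h)) as (F & HF & Hmf).
    destruct (Hh F) as [(n & y & Hv & Hy) | [k Hk]].
    { elim Hy. eapply value_det; [exact Hv | apply HF]. }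
    (* Removing the single code in row [k] is a finite change, yet [F] must still halt at [k]. *)
    pose (C c := if cfst c =? k then false else coded (graph_oracle h) c).
    destruct (Hmf C) as [Htot _].
    { exists [cpair k (cpair (Nat.b2n (snd (h k))) (fst (h k)))]. intros c Hc. left.
      unfold C in Hc. destruct (Nat.eqb_spec (cfst c) k) as [E | E]; [| easy].
      destruct (coded (graph_oracle h) c) eqn:Ec; [| easy].
      apply coded_true in Ec as (n & x & l & -> & E').
      rewrite cfst_cpair in E. subst n. apply graph_oracle_true in E'. now rewrite E'. }
    destruct (Htot k) as [y [q R]].
    (* The delay [S (list_max q)] puts the new code of row [k] beyond all queries, so [F] gives [y]
       again, while the bit is chosen different from [y]. *)
    pose (h' n := if n =? k then (S (list_max q), y =? 0) else h n).
    apply (Hk h'); [apply agree_upd |].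
    exists k, y. split.
    + exists q. eapply run_use; [exact R |]. intros c Hc%in_list_max. unfold C.
      destruct (Nat.eqb_spec (cfst c) k) as [E | E].
      * destruct (coded (graph_oracle h') c) eqn:Ec; [| easy].
        apply coded_true in Ec as (n & x & l & -> & E').
        rewrite cfst_cpair in E. subst n. apply graph_oracle_true in E'.
        unfold h' in E'. rewrite Nat.eqb_refl in E'. injection E' as <- <-.
        match type of Hc with cpair ?a (cpair ?b ?d) <= _ =>
          specialize (le_cpair_r a (cpair b d)); specialize (le_cpair_r b d) end. lia.
      * apply coded_ext. intros x l. unfold graph_oracle, h'.
        now rewrite (proj2 (Nat.eqb_neq _ _) E).
    + unfold h'. rewrite Nat.eqb_refl. simpl. now destruct y.
Qed.

(** * Cofinite does not imply use-bounded-from-below *)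

Notation layout := (nat -> bool * option (nat * bool)) (only parsing).

(** The oracle consists of guard bits and of rows, one for each [n]. Row [n] normally has
    one element, which reveals the bit [n] of the set to be computed. Guard [m] is set only
    if the bits at all [n] with [cfst n = m] are [0], and these rows may then be empty. *)
Definition guard (g : layout) (m : nat) : bool := fst (g m).

Definition row (g : layout) (n : nat) : option (nat * bool) :=
  match snd (g n) with
  | Some (k, b) => Some (k, b && negb (guard g (cfst n)))
  | None => if guard g (cfst n) then None else Some (0, false)
  end.

(** First component 0 holds the guards, and first component [S n] holds row [n]. *)
Definition rows (g : layout) : set := fun c =>
  match cfst c with
  | 0 => guard g (csnd c)
  | S n => match row g n with Some (k, b) => csnd c =? cpair k (Nat.b2n b) | None => false end
  end.

Definition row_bit (g : layout) : set := fun n =>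
  match row g n with Some (_, b) => b | None => false end.

Lemma row_agree n g g' : agree (S n) g g' -> row g n = row g' n.
Proof.
  intros H. unfold row, guard. rewrite (H n), (H (cfst n)); [easy | | lia].
  specialize (cfst_le n). lia.
Qed.

Lemma continuous_rows : continuous rows.
Proof.
  intros c g. exists (S c). intros g' H. unfold rows.
  generalize (cfst_le c), (csnd_le c). destruct (cfst c) as [|n]; intros H1 H2.
  - unfold guard. now rewrite H by lia.
  - rewrite (row_agree n g g'); [easy |]. eapply agree_le; [| exact H]. lia.
Qed.

Lemma continuous_row_bit : continuous row_bit.
Proof.
  intros c g. exists (S c). intros g' H. unfold row_bit. now rewrite (row_agree c g g' H).
Qed.

(** The inputs of [AskGuard], [AskRow] and [NoAnswer] have the form [cpair n (cpair l d)],
    with [l] a number of steps and [d] a position in row [n]. *)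
Definition AskGuard : functional :=
  Comp Oracle (Pair (Pair Zero (Comp Left Left)) (Pair (Const 1) (Comp Left Right))).
Definition AskRow : functional :=
  Comp Oracle (Pair (Pair (Comp Succ Left) (Comp Right Right)) (Pair (Const 1) (Comp Left Right))).
Definition NoAnswer : functional :=
  Comp When (Pair (Comp IsZero AskGuard) (Comp IsZero AskRow)).
(** Searches for a pair of a number of steps and a position until the guard or the row gives a
    positive answer. The bit is read off the position if the row answered, and is 0 otherwise. *)
Definition RowBit : functional :=
  Comp (Comp When (Pair (Comp Right (Comp Right Right)) AskRow))
       (Pair Id (Comp (Mu NoAnswer) (Pair Id Zero))).

Lemma ev_ask_guard P n l d : ev (coded P) AskGuard (cpair n (cpair l d))
  (Nat.b2n (P (cpair 0 (cfst n)) true l)) (fun _ => True).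
Proof.
  rewrite <- coded_cpair. eapply ev_comp; [| now apply ev_oracle].
  apply ev_pair; [evs |]. apply ev_pair; [apply ev_const | evs].
Qed.

Lemma ev_ask_row P n l d : ev (coded P) AskRow (cpair n (cpair l d))
  (Nat.b2n (P (cpair (S n) d) true l)) (fun _ => True).
Proof.
  rewrite <- coded_cpair. eapply ev_comp; [| now apply ev_oracle].
  apply ev_pair; [evs |]. apply ev_pair; [apply ev_const | evs].
Qed.

Lemma ev_no_answer P n l d : ev (coded P) NoAnswer (cpair n (cpair l d))
  (Nat.b2n (negb (P (cpair 0 (cfst n)) true l || P (cpair (S n) d) true l))) (fun _ => True).
Proof.
  replace (Nat.b2n _) with
    (match is_zero (Nat.b2n (P (cpair (S n) d) true l)) with 0 => 0
     | S _ => is_zero (Nat.b2n (P (cpair 0 (cfst n)) true l)) end)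
    by now destruct (P (cpair (S n) d) true l), (P (cpair 0 (cfst n)) true l).
  eapply ev_comp; [| apply ev_when].
  apply ev_pair; (eapply ev_comp; [| apply ev_is_zero]);
    [apply ev_ask_guard | apply ev_ask_row].
Qed.

Lemma compatible_row_bit P g :
  partial_oracle (rows g) P -> compatible RowBit (coded P) (row_bit g).
Proof.
  intros HP n y (p & (p1 & w & Hp1 & (p2 & Hp2 & Hw)%value_comp_inv & ->)%value_pair_inv
    & Hy)%value_comp_inv.
  assert (p1 = n) as -> by (eapply value_det; [exact Hp1 | apply value_ev, ev_id]).
  assert (p2 = cpair n 0) as -> by (eapply value_det; [exact Hp2 | apply value_ev; evs]).
  apply value_mu_zero in Hw. rewrite cfst_cpair in Hw.
  rewrite <- (cpair_eta w) in Hw, Hy. set (l := cfst w) in *. set (d := csnd w) in *.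
  pose proof (value_det _ _ _ _ _ Hw (ev_value _ _ _ _ _ (ev_no_answer P n l d))) as Hans.
  assert (Hy' : y = match Nat.b2n (P (cpair (S n) d) true l) with 0 => 0 | S _ => csnd d end).
  { eapply value_det; [exact Hy |]. eapply ev_value.
    eapply ev_comp; [| apply ev_when]. apply ev_pair; [evs | apply ev_ask_row]. }
  rewrite Hy'. unfold row_bit.
  destruct (P (cpair (S n) d) true l) eqn:Er.
  - apply HP in Er. unfold rows in Er. rewrite cfst_cpair, csnd_cpair in Er.
    destruct (row g n) as [[k b] |]; [| easy].
    apply Nat.eqb_eq in Er as ->. simpl. apply csnd_cpair.
  - rewrite orb_false_r in Hans.
    destruct (P (cpair 0 (cfst n)) true l) eqn:Eg; [| easy].
    apply HP in Eg. unfold rows in Eg. rewrite cfst_cpair, csnd_cpair in Eg.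
    unfold row. rewrite Eg. destruct (snd (g n)) as [[k b] |]; [| easy].
    simpl. now rewrite andb_false_r.
Qed.

Lemma dom_row_bit P n l d :
  P (cpair 0 (cfst n)) true l = true \/ P (cpair (S n) d) true l = true ->
  dom RowBit (coded P) n.
Proof.
  intros H.
  pose (ans w := P (cpair 0 (cfst n)) true (cfst w) || P (cpair (S n) (csnd w)) true (cfst w)).
  assert (Hans : forall w, ev (coded P) NoAnswer (cpair n w) (Nat.b2n (negb (ans w)))
    (fun _ => True)).
  { intros w. rewrite <- (cpair_eta w) at 1. apply ev_no_answer. }
  destruct (dec_inh_nat_subset_has_unique_least_element (fun w => ans w = true))
    as (w & [Hw Hleast] & _).
  { intros w. destruct (ans w); auto. }
  { exists (cpair l d). unfold ans. rewrite cfst_cpair, csnd_cpair. now apply orb_true_iff. }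
  eexists. apply (ev_value _ _ _ _ (fun _ => True)). eapply ev_comp.
  - apply ev_pair; [apply ev_id |]. eapply ev_comp; [evs |]. apply (ev_mu _ _ _ _ _ w); [lia | |].
    + intros j Hj. exists 0. generalize (Hans j).
      destruct (ans j) eqn:E; [apply Hleast in E; lia | easy].
    + generalize (Hans w). now rewrite Hw.
  - rewrite <- (cpair_eta w) at 1. eapply ev_comp; [| apply ev_when].
    apply ev_pair; [evs | apply ev_ask_row].
Qed.

Lemma odom_true A P c : partial_oracle A P -> odom P c -> A c = true ->
  exists l, P c true l = true.
Proof.
  intros HP ([|] & l & H) Hc; [now exists l |]. apply HP in H. congruence.
Qed.

(** Only empty rows depend on their guard. By the hypothesis, almost all of them have guards beyond
    any given finite part of the oracle, so [RowBit] halts almost everywhere when finitely many bits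
    are missing. *)
Lemma row_bit_cf g :
  (forall m, exists k, forall n, k <= n -> snd (g n) = None -> m <= cfst n) ->
  le_cf (row_bit g) (rows g).
Proof.
  intros Hg. exists RowBit.
  assert (Hdom : forall P n, partial_oracle (rows g) P ->
    (forall d, odom P (cpair (S n) d)) -> (row g n = None -> odom P (cpair 0 (cfst n))) ->
    dom RowBit (coded P) n).
  { intros P n HP Hrow Hguard. destruct (row g n) as [[k b] |] eqn:E.
    - destruct (odom_true (rows g) P (cpair (S n) (cpair k (Nat.b2n b))) HP) as [l Hl].
      + apply Hrow.
      + unfold rows. rewrite cfst_cpair, csnd_cpair, E. apply Nat.eqb_refl.
      + eapply dom_row_bit. right. exact Hl.
    - destruct (odom_true (rows g) P (cpair 0 (cfst n)) HP) as [l Hl]; [auto | |].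
      + unfold rows. rewrite cfst_cpair, csnd_cpair. unfold row in E.
        destruct (snd (g n)) as [[] |]; [easy |]. now destruct (guard g (cfst n)).
      + eapply (dom_row_bit P n l 0). left. exact Hl. }
  split.
  - intros n. pose proof (partial_oracle_self (rows g)) as HP.
    destruct (Hdom (self_oracle (rows g)) n HP) as [y Hy]; try (intros; apply odom_self).
    unfold agrees_at. rewrite <- (compatible_row_bit _ g HP n y Hy). exact Hy.
  - intros P HP [N HN]%cofinite_bound. split; [now apply compatible_row_bit |].
    destruct (Hg N) as [k Hk]. apply (cofinite_ge _ (max N k)). intros n Hn.
    apply Hdom; [easy | |].
    + intros d. apply HN. specialize (le_cpair_l (S n) d). lia.
    + intros E. apply HN. eapply Nat.le_trans; [| apply le_cpair_r]. apply (Hk n); [lia |].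
      unfold row in E. now destruct (snd (g n)) as [[] |].
Qed.

(** [u] is to be larger than all bits used by the computation to be preserved. *)
Definition fill (g : layout) (k u : nat) (z r : nat -> bool) :
  layout := fun n =>
  if n <? k then g n
  else (z n, Some (match row g n with Some v => v | None => (u, r n) end)).

Lemma fill_agree g k u z r : agree k g (fill g k u z r).
Proof. intros n Hn. unfold fill. now rewrite (proj2 (Nat.ltb_lt n k) Hn). Qed.

Lemma guard_fill g k u z r m : k <= m -> guard (fill g k u z r) m = z m.
Proof. intros H. unfold guard, fill. now rewrite (proj2 (Nat.ltb_ge m k) H). Qed.

(** Nonempty rows are stored as they were. A stored bit 1 would be suppressed only by a newly set
    guard, which the hypothesis on [z] forbids. *)
Lemma row_fill g k u z r n : k <= n ->
  (forall m, k <= m -> z m = true -> guard g m = true) ->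
  row (fill g k u z r) n = match row g n with Some v => Some v
    | None => Some (u, r n && negb (guard (fill g k u z r) (cfst n))) end.
Proof.
  intros Hn Hz. unfold row at 1. unfold fill at 1. rewrite (proj2 (Nat.ltb_ge n k) Hn).
  simpl. destruct (row g n) as [[j b] |] eqn:E; [| easy].
  do 2 f_equal. destruct b; [| easy].
  destruct (guard (fill g k u z r) (cfst n)) eqn:Eg; [| easy]. exfalso.
  assert (Hgd : guard g (cfst n) = true).
  { destruct (le_lt_dec k (cfst n)) as [H | H].
    - apply Hz; [easy |]. now rewrite guard_fill in Eg.
    - unfold guard, fill in Eg. now rewrite (proj2 (Nat.ltb_lt _ k) H) in Eg. }
  unfold row in E. rewrite Hgd in E.
  destruct (snd (g n)) as [[j' b'] |]; [| easy].
  injection E as _ E. now rewrite andb_false_r in E.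
Qed.

(** A row that was empty receives an element with code at least [u], so below [u] only a change of
    guards could be seen. *)
Lemma rows_fill g k u z r c : c < u ->
  (forall m, k <= m -> z m = true -> guard g m = true) ->
  (forall m, k <= m -> c = cpair 0 m -> z m = guard g m) ->
  rows (fill g k u z r) c = rows g c.
Proof.
  intros Hc Hz Hm. unfold rows. rewrite <- (cpair_eta c) in Hc, Hm.
  destruct (cfst c) as [|n].
  - destruct (le_lt_dec k (csnd c)) as [H | H].
    + rewrite guard_fill by easy. auto.
    + unfold guard. now rewrite <- (fill_agree g k u z r) by easy.
  - destruct (le_lt_dec k n) as [H | H].
    + rewrite row_fill by easy. destruct (row g n); [easy |].
      apply Nat.eqb_neq. intros E. rewrite E in Hc.
      match type of Hc with cpair ?a (cpair ?b ?d) < _ =>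
        specialize (le_cpair_r a (cpair b d)); specialize (le_cpair_l b d) end. lia.
    + now rewrite <- (row_agree n g) by (eapply agree_le; [| apply fill_agree]; lia).
Qed.

Lemma le_cf_not_ubfb : ~ implies le_cf le_ubfb.
Proof.
  intros Himp.
  pose (T := (bool * option (nat * bool))%type).
  (* After a condition of length [k], a row may be left empty only if its guard has index at least
     [k]. This secures the hypothesis of [row_bit_cf] for the generic layout. *)
  pose (W k n (t : T) := snd t = None -> k <= cfst n).
  (* Failure includes divergence as well as wrong values, and is required on a whole neighbourhood,
     which makes it open. *)
  pose (fails F (g : nat -> T) := exists n k, forall g', agree k g g' ->
    ~ agrees_at F (rows g') (row_bit g') n).
  pose (asks F m N (g : nat -> T) := exists n y q, N <= n /\
    run (rows g) F n y q /\ In (cpair 0 m) q).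
  pose (guarded k (g : nat -> T) := exists m, k <= m /\ guard g m = true).
  pose (U i g := match i with inl F => fails F g | inr (inl (F, (m, N))) => asks F m N g
    | inr (inr k) => guarded k g end).
  destruct (generic_exists T (functional + (functional * (nat * nat) + nat))
    (false, Some (0, false)) W) with (U := U)
    as (g & Hadm & Hgen).
  - easy.
  - intros k k' n t Hk Ht H. specialize (Ht H). lia.
  - intros [F | [(F & m & N) | k]] g.
    + intros (n & k & H). exists k. intros g' Hg'. exists n, k.
      intros g'' Hg''. apply H. eapply agree_trans; eassumption.
    + intros (n & y & q & Hn & R & Hq).
      destruct (continuous_run rows F g n y q continuous_rows R) as [k Hk].
      exists k. intros g' Hg'. exists n, y, q. auto.
    + intros (m & Hm & H). exists (S m). intros g' Hg'. exists m.
      unfold guard. now rewrite <- Hg' by lia.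
  - repeat first [apply countable_sum | apply countable_prod
      | apply countable_functional | apply countable_nat].
  - destruct (Himp (row_bit g) (rows g)) as (F & HF & Hu).
    { apply row_bit_cf. intros m. destruct (Hadm m) as (k & Hk & _ & H).
      exists k. intros n Hn E. specialize (H n Hn E). lia. }
    destruct (Hgen (inl F)) as (k & [_ HWk] & [(n & j & H) | Hk]).
    { apply (H g (agree_refl _ _)), HF. }
    (* Setting a late guard is compatible with every condition, so a generic layout has one set
       beyond [k]. *)
    assert (Hguard : exists m, k <= m /\ guard g m = true).
    { destruct (Hgen (inr (inr k))) as (j & [_ HWj] & [H | H]); [exact H |].
      elim (H (fun n => if n <? j then g n else (true, Some (0, false)))).
      - split; intros n Hn.
        + now rewrite (proj2 (Nat.ltb_lt n j) Hn).
        + now rewrite (proj2 (Nat.ltb_ge n j) Hn).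
      - exists (max k j). split; [lia |]. unfold guard.
        now rewrite (proj2 (Nat.ltb_ge _ j)) by lia. }
    destruct Hguard as (m & Hm & Hgm).
    destruct (Hu (cpair 0 m)) as [N HN].
    destruct (Hgen (inr (inl (F, (m, N))))) as (k2 & [_ HW2] & [(n & y & q & Hn & R & Hq) | H2]).
    { elim (HN n Hn y q R Hq). }
    (* Whatever rows are left empty: a computation is finite, so that the empty rows can be
       filled beyond its use. *)
    assert (Hask : forall g', agree k2 g g' -> ~ asks F m N g').
    { intros g' Hg' (n & y & q & Hn & R & Hq).
      apply (H2 (fill g' k2 (S (list_max q)) (guard g') (fun _ => false))).
      - split.
        + eapply agree_trans; [exact Hg' | apply fill_agree].
        + intros i Hi. unfold W, fill. now rewrite (proj2 (Nat.ltb_ge i k2) Hi).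
      - exists n, y, q. split; [easy | split; [| easy]].
        eapply run_use; [exact R |]. intros c Hc%in_list_max. symmetry.
        apply rows_fill; auto. lia. }
    (* [L] lies beyond both conditions, guard [m] and the bound [N]; then [n = cpair m L] is a late
       input with guard [m]. *)
    pose (L := max (max k k2) (max (S m) N)).
    pose (n := cpair m L).
    assert (HLn : L <= n) by apply le_cpair_r.
    assert (Hcn : cfst n = m) by apply cfst_cpair.
    (* Leaving row [n] empty respects condition [k], as [cfst n = m >= k], but possibly not [k2];
       hence [Hask] is stated without the restriction on empty rows. *)
    pose (s i := if i <? L then g i else (true, if i =? n then None else Some (0, false))).
    assert (Hs : forall i, i < L -> s i = g i).
    { intros i Hi. unfold s. now rewrite (proj2 (Nat.ltb_lt i L) Hi). }
    assert (Hsk : admissible T W k g s).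
    { split.
      - intros i Hi. rewrite Hs by lia. easy.
      - intros i Hi. destruct (le_lt_dec L i) as [H | H]; [| rewrite Hs by lia; auto].
        unfold s. rewrite (proj2 (Nat.ltb_ge i L) H).
        destruct (Nat.eqb_spec i n) as [-> |]; [| easy].
        intros _. now rewrite Hcn. }
    apply Hk in Hsk.
    (* As [F] does not fail at [s], some layout close to [s] gives a correct value at [n]. It need
       not be admissible, which the later use of [fill] repairs. *)
    assert (Hg' : exists g', agree (S n) s g' /\ agrees_at F (rows g') (row_bit g') n).
    { apply NNPP. intros H. apply Hsk. exists n, (S n). intros g' Ha Hb. apply H. eauto. }
    destruct Hg' as (g' & Hsg & Hagree).
    assert (Hgg' : agree L g g').
    { intros i Hi. rewrite <- Hs by easy. apply Hsg. lia. }
    assert (Hguard' : guard g' m = true).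
    { unfold guard. rewrite <- Hgg' by lia. exact Hgm. }
    assert (Hrow : row g' n = None).
    { unfold row. rewrite Hcn, Hguard', <- Hsg by lia.
      unfold s. now rewrite (proj2 (Nat.ltb_ge n L) HLn), Nat.eqb_refl. }
    unfold agrees_at, row_bit in Hagree. rewrite Hrow in Hagree.
    destruct Hagree as [q R].
    assert (Hq : ~ In (cpair 0 m) q).
    { intros Hq. apply (Hask g'); [eapply agree_le; [| exact Hgg']; lia |].
      exists n, (Nat.b2n false), q. split; [lia | easy]. }
    (* Unsetting the guard and revealing the bit 1 in row [n] is not noticed. *)
    pose (z i := if i =? m then false else guard g' i).
    pose (g2 := fill g' k (S (list_max q)) z (fun i => i =? n)).
    assert (R2 : run (rows g2) F n 0 q).
    { eapply run_use; [exact R |]. intros c Hc. symmetry. apply rows_fill.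
      - apply in_list_max in Hc. lia.
      - intros i _. unfold z. now destruct (i =? m).
      - intros i _ ->. unfold z. now destruct (Nat.eqb_spec i m) as [-> |]. }
    assert (Hbit : row_bit g2 n = true).
    { unfold row_bit, g2. rewrite row_fill; [| lia |].
      - rewrite Hrow, Nat.eqb_refl, Hcn, guard_fill by easy.
        unfold z. now rewrite Nat.eqb_refl.
      - intros i _. unfold z. now destruct (i =? m). }
    apply (Hk g2).
    + split.
      * eapply agree_trans; [| apply fill_agree]. eapply agree_le; [| exact Hgg']. lia.
      * intros i Hi. unfold W, g2, fill. now rewrite (proj2 (Nat.ltb_ge i k) Hi).
    (* On a neighbourhood of [g2] the functional outputs 0 at [n] although the bit is 1, so [g2] is
       a failure that [k] excludes. *)
    + destruct (continuous_run rows F g2 n 0 q continuous_rows R2) as [j Hj].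
      destruct (continuous_row_bit n g2) as [j' Hj'].
      exists n, (max j j'). intros g3 Hg3 Hv. unfold agrees_at in Hv.
      rewrite <- (Hj' g3), Hbit in Hv by (eapply agree_le; [| exact Hg3]; lia).
      assert (H0 : value F (rows g3) n 0).
      { exists q. apply Hj. eapply agree_le; [| exact Hg3]. lia. }
      now apply (value_det _ _ _ _ _ H0) in Hv.
Qed.

(** * Density *)

Lemma card_below_mono (P P' : nat -> Prop) n :
  (forall i, i < n -> P i -> P' i) -> card_below P n <= card_below P' n.
Proof.
  intros H. apply NoDup_incl_length.
  - apply NoDup_filter, seq_NoDup.
  - intros i [Hi Hc]%filter_In. apply filter_In. split; [easy |].
    apply in_seq in Hi. apply chi_true, H; [lia |]. now apply chi_true.
Qed.

Lemma card_below_compl P n : card_below P n + card_below (fun i => ~ P i) n = n.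
Proof.
  unfold card_below. rewrite <- (length_seq n 0) at 3.
  rewrite <- (filter_length (chi P) (seq 0 n)). do 2 f_equal.
  apply filter_ext. intros i. unfold chi.
  destruct (excluded_middle_informative (P i)), (excluded_middle_informative (~ P i)); tauto.
Qed.

Lemma card_below_incl P n l : (forall i, i < n -> P i -> In i l) -> card_below P n <= length l.
Proof.
  intros H. apply NoDup_incl_length.
  - apply NoDup_filter, seq_NoDup.
  - intros i [Hi Hc]%filter_In. apply in_seq in Hi. apply H; [lia |]. now apply chi_true.
Qed.

(** The complement has at most [sqrt (c * n)] elements below [n], a fraction of at most
    [sqrt (c / n)]. This is below [eps] once [n] exceeds [c / eps^2]. *)
Lemma density1_of_sqrt P c :
  (forall n, card_below (fun i => ~ P i) n * card_below (fun i => ~ P i) n <= c * n) ->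
  density1 P.
Proof.
  intros H eps Heps.
  destruct (INR_unbounded (INR c / (eps * eps))) as [N HN].
  exists (S N). intros n Hn. unfold R_dist.
  set (a := card_below (fun i => ~ P i) n) in *.
  assert (Hn0 : (0 < INR n)%R) by (apply lt_0_INR; lia).
  assert (Ha : (INR (card_below P n) = INR n - INR a)%R).
  { rewrite <- (card_below_compl P n) at 2. rewrite plus_INR. fold a. lra. }
  assert (Ha0 : (0 <= INR a)%R) by apply pos_INR.
  replace (INR (card_below P n) / INR n - 1)%R with (- (INR a / INR n))%R
    by (rewrite Ha; field; lra).
  rewrite Rabs_Ropp, Rabs_right by (apply Rle_ge, Rle_mult_inv_pos; lra).
  apply (Rmult_lt_reg_r (INR n)); [easy |]. unfold Rdiv.
  rewrite Rmult_assoc, Rinv_l, Rmult_1_r by lra.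
  specialize (H n). fold a in H. apply le_INR in H. rewrite !mult_INR in H.
  assert (HNn : (INR N < INR n)%R) by (apply lt_INR; lia).
  assert (Hc : (INR c < INR n * (eps * eps))%R).
  { assert (He : (0 < eps * eps)%R) by nra.
    apply (Rmult_lt_reg_r (/ (eps * eps))); [now apply Rinv_0_lt_compat |].
    rewrite Rmult_assoc, Rinv_r, Rmult_1_r by lra. exact (Rlt_trans _ _ _ HN HNn). }
  destruct (Rlt_le_dec (INR a) (eps * INR n)) as [Hlt | Hge]; [easy |].
  assert (0 <= eps * INR n)%R by (apply Rmult_le_pos; lra).
  assert ((eps * INR n) * (eps * INR n) <= INR a * INR a)%R by now apply Rmult_le_compat.
  apply (Rmult_lt_compat_r (INR n)) in Hc; [lra | easy].
Qed.

Lemma density1_half P : density1 P ->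
  exists N, forall n, N <= n -> 0 < n -> n < 2 * card_below P n.
Proof.
  intros H. destruct (H (1 / 2)%R) as [N HN]; [lra |].
  exists N. intros n Hn Hpos. specialize (HN n Hn). unfold R_dist in HN.
  apply Rabs_def2 in HN as [_ HN].
  assert (Hn0 : (0 < INR n)%R) by (apply lt_0_INR; lia).
  apply INR_lt. rewrite mult_INR. simpl INR.
  assert (1 / 2 < INR (card_below P n) / INR n)%R by lra.
  apply (Rmult_lt_compat_r (INR n)) in H0; [| easy].
  unfold Rdiv in H0. rewrite (Rmult_assoc (INR _)), Rinv_l in H0 by lra. lra.
Qed.

Lemma density1_infinite P : density1 P -> infinite P.
Proof.
  intros [N HN]%density1_half [l Hl].
  specialize (HN (S (max N (2 * length l))) ltac:(lia) ltac:(lia)).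
  pose proof (card_below_incl P (S (max N (2 * length l))) l ltac:(auto)). lia.
Qed.

(** Codes of pairs [(n, 0)] are the triangular numbers. *)
Definition off_axis (c : nat) : Prop := csnd c <> 0.

(** The triangular number of [t] is below [n] only if [t <= s = sqrt (2n)], which leaves at most
    [s + 1 <= 2s] of them; the constant 8 comes from [4 * s^2 <= 8n]. *)
Lemma card_on_axis n :
  card_below (fun c => ~ off_axis c) n * card_below (fun c => ~ off_axis c) n <= 8 * n.
Proof.
  set (s := Nat.sqrt (2 * n)).
  destruct (Nat.eq_dec n 0) as [-> | Hn]; [easy |].
  assert (Hs : s * s <= 2 * n < S s * S s) by apply Nat.sqrt_specif.
  assert (H : card_below (fun c => ~ off_axis c) n <=
    length (map (fun t => cpair t 0) (seq 0 (S s)))).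
  { apply card_below_incl. intros c Hc Hax. unfold off_axis in Hax.
    rewrite <- (cpair_eta c). replace (csnd c) with 0 by lia.
    apply in_map_iff. exists (cfst c). split; [easy |]. apply in_seq.
    specialize (cpair_spec (cfst c) (csnd c)). rewrite cpair_eta. nia. }
  rewrite length_map, length_seq in H.
  assert (1 <= s) by nia. nia.
Qed.

Lemma density1_sup P : (forall c, off_axis c -> P c) -> density1 P.
Proof.
  intros H. apply (density1_of_sqrt _ 8). intros n.
  eapply Nat.le_trans; [| apply card_on_axis].
  assert (card_below (fun c => ~ P c) n <= card_below (fun c => ~ off_axis c) n)
    by (apply card_below_mono; auto).
  nia.
Qed.

(** * Generic, coarse and infinite-information reducibility *)

Definition on_axis (D : set) : set := fun c => (csnd c =? 0) && D (cfst c).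

Lemma on_axis_off D c : off_axis c -> on_axis D c = false.
Proof. intros H%Nat.eqb_neq. unfold on_axis. now rewrite H. Qed.

Lemma on_axis_pair D n : on_axis D (cpair n 0) = D n.
Proof. unfold on_axis. now rewrite cfst_cpair, csnd_cpair. Qed.

Lemma le_1_on_axis D : le_1 D (on_axis D).
Proof.
  exists (fun n => cpair n 0). split; [| split].
  - apply (computable_of_ev (Pair Id Zero)). intros n. evs.
  - now intros m n [H _]%cpair_inj.
  - intros n. now rewrite on_axis_pair.
Qed.

(** Take [D] generic relative to the fixed oracle [X]. If [F] never conflicts with [D], some initial
    segment of [D] excludes conflicts, so any later output could be contradicted by changing one
    bit. *)
Lemma immune_exists X : exists D, forall F, compatible F X D -> finite (dom F X).
Proof.
  destruct (cohen_generic_exists false (fun F (g : set) =>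
    exists n y, value F X n y /\ y <> Nat.b2n (g n))) as [D HD].
  - intros F. apply (open_conflict (fun _ => X) (fun g => g)); [now exists 0 | apply continuous_id].
  - apply countable_functional.
  - exists D. intros F HF. destruct (HD F) as [(n & y & Hv & Hy) | [k Hk]].
    + elim Hy. now apply HF.
    + apply (finite_le _ k). intros n [y Hv].
      destruct (le_lt_dec n k) as [H | H]; [easy |].
      elim (Hk (fun i => if i =? n then y =? 0 else D i)).
      * intros i Hi. now rewrite (proj2 (Nat.eqb_neq i n)) by lia.
      * exists n, y. rewrite Nat.eqb_refl. split; [easy | now destruct y].
Qed.

Lemma coarsely_immune_exists X : exists D, forall F, ~ density1 (agrees_at F X D).
Proof.
  destruct (cohen_generic_exists false (fun i (g : set) => exists n, snd i <= n /\ 0 < n /\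
    2 * card_below (agrees_at (fst i) X g) n <= n)) as [D HD].
  - intros [F N] g (n & Hn & H0 & H). exists n. intros g' Hg'. exists n.
    split; [easy | split; [easy |]].
    assert (card_below (agrees_at F X g') n <= card_below (agrees_at F X g) n).
    { apply card_below_mono. intros i Hi. unfold agrees_at. now rewrite Hg'. }
    simpl in *. lia.
  - apply countable_prod; [apply countable_functional | apply countable_nat].
  - exists D. intros F [N HN]%density1_half.
    destruct (HD (F, N)) as [(n & Hn & H0 & H) | [k Hk]].
    + specialize (HN n Hn H0). simpl in H. lia.
    (* From [m] on the set contradicts [F], so below [2 * m] at most the first half can agree. *)
    + pose (m := S (max k N)).
      apply (Hk (fun i => if i <? m then D i else negb (chi (agrees_at F X (fun _ => true)) i))).
      * intros i Hi. now rewrite (proj2 (Nat.ltb_lt i m)) by lia.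
      * exists (2 * m). simpl fst. simpl snd. split; [lia | split; [lia |]].
        apply Nat.mul_le_mono_l. rewrite <- (length_seq m 0) at 2.
        apply card_below_incl. intros i _ Hi. apply in_seq.
        destruct (Nat.ltb_spec i m) as [H | H]; [lia |]. exfalso.
        unfold agrees_at at 1 in Hi. rewrite (proj2 (Nat.ltb_ge i m) H) in Hi.
        destruct (chi (agrees_at F X (fun _ => true)) i) eqn:E.
        -- apply chi_true in E. now apply (value_det _ _ _ _ _ Hi) in E.
        -- apply not_true_iff_false in E. apply E, chi_true. exact Hi.
Qed.

(** A single partial oracle for all the sets [on_axis D]: it answers 0 off the axis and reveals
    nothing about [D]. *)
Definition axis_oracle : triples := fun c x _ => negb x && negb (csnd c =? 0).

Lemma partial_oracle_axis D : partial_oracle (on_axis D) axis_oracle.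
Proof.
  intros c l. unfold axis_oracle, on_axis. destruct (csnd c =? 0); split; easy.
Qed.

Lemma odom_axis c : off_axis c -> odom axis_oracle c.
Proof.
  intros H%Nat.eqb_neq. exists false, 0. unfold axis_oracle. now rewrite H.
Qed.

(** With the fixed oracle [axis_oracle], a generic reduction would give a correct partial
    description of [D] on an infinite domain, while [D] is immune to such descriptions. *)
Lemma le_1_not_g : ~ implies le_1 le_g.
Proof.
  intros Himp. destruct (immune_exists (coded axis_oracle)) as [D HD].
  destruct (Himp _ _ (le_1_on_axis D)) as [F HF].
  destruct (HF axis_oracle) as [Hd Hc].
  - apply partial_oracle_axis.
  - apply density1_sup, odom_axis.
  - apply density1_infinite in Hd. apply Hd, HD, Hc.
Qed.

Lemma le_1_not_ii : ~ implies le_1 le_ii.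
Proof.
  intros Himp. destruct (immune_exists (coded axis_oracle)) as [D HD].
  destruct (Himp _ _ (le_1_on_axis D)) as [F HF].
  destruct (HF axis_oracle) as [Hc Hd].
  - apply partial_oracle_axis.
  - apply density1_infinite, density1_sup, odom_axis.
  - apply Hd, HD, Hc.
Qed.

Lemma le_1_not_cor : ~ implies le_1 le_cor.
Proof.
  intros Himp. destruct (coarsely_immune_exists (fun _ => false)) as [D HD].
  destruct (Himp _ _ (le_1_on_axis D)) as [F HF].
  apply (HD F), HF, density1_sup. intros c Hc. now rewrite on_axis_off.
Qed.

Lemma not_le_T_empty : exists D, ~ le_T (on_axis D) (fun _ => false).
Proof.
  destruct (immune_exists (fun _ => false)) as [D HD]. exists D. intros [F HF].
  pose (F' := Comp F (Pair Id Zero)).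
  assert (HF' : computes F' (fun _ => false) D).
  { intros n. apply value_ev. eapply ev_comp; [evs |].
    apply value_ev. rewrite <- on_axis_pair. apply HF. }
  destruct (HD F') as [l Hl].
  - intros n y Hy. eapply value_det; [exact Hy | apply HF'].
  - assert (H : In (S (list_max l)) l) by (apply Hl; eexists; apply HF').
    apply in_list_max in H. lia.
Qed.

(** The test does not depend on the search variable, so the search either succeeds at once with 0 or
    never ends. The latter happens exactly on the axis. *)
Definition OffAxis : functional :=
  Comp (Mu (Comp IsZero (Comp Right Left))) (Pair Id Zero).

Lemma value_off_axis X c : off_axis c -> value OffAxis X c 0.
Proof.
  intros H. apply value_ev. eapply ev_comp; [evs |]. apply ev_mu_found.
  replace 0 with (is_zero (csnd c)) at 2 by (unfold off_axis in H; now destruct (csnd c)).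
  eapply ev_comp; [| apply ev_is_zero]. evs.
Qed.

Lemma compatible_off_axis X D : compatible OffAxis X (on_axis D).
Proof.
  intros c y Hy.
  assert (H : off_axis c).
  { intros E. apply value_comp_inv in Hy as (p & Hp & Hmu).
    assert (p = cpair c 0) as -> by (eapply value_det; [exact Hp | apply value_ev; evs]).
    apply value_mu_zero in Hmu. rewrite cfst_cpair in Hmu.
    assert (H1 : value (Comp IsZero (Comp Right Left)) X (cpair c y) 1).
    { apply value_ev. eapply ev_comp; [evs |]. rewrite E. apply (ev_is_zero X _ 0). }
    now apply (value_det _ _ _ _ _ Hmu) in H1. }
  rewrite on_axis_off by easy. eapply value_det; [exact Hy | now apply value_off_axis].
Qed.

(** Off the axis, a set of density 1, the value 0 is always right, so no information from [A] is
    required. *)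
Lemma other_le_on_axis s D A : other_le s (on_axis D) A.
Proof.
  assert (Hdom : forall X, density1 (dom OffAxis X)).
  { intros X. apply density1_sup. intros c Hc. exists 0. now apply value_off_axis. }
  destruct s.
  - exists OffAxis. intros P _ _. split; [apply Hdom | apply compatible_off_axis].
  - exists Zero. intros C _. split.
    + intros n. exists 0. apply value_ev, ev_zero.
    + apply density1_sup. intros c Hc. unfold agrees_at. rewrite on_axis_off by easy.
      apply value_ev, ev_zero.
  - exists OffAxis. intros P _ _. split; [apply compatible_off_axis |].
    apply density1_infinite, Hdom.
Qed.

(** * Combining implications and separations *)

Lemma implies_trans R S T : implies R S -> implies S T -> implies R T.
Proof. intros H1 H2 B A H. apply H2, H1, H. Qed.

Lemma arrow_implies r s : arrow r s -> implies (base_le r) (base_le s).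
Proof.
  intros []; simpl; auto using le_1_mr, le_mr_T, le_1_mf, le_mf_ubfb, le_ubfb_cf, le_cf_T.
Qed.

Lemma path_implies r s : clos_refl_trans base_red arrow r s -> implies (base_le r) (base_le s).
Proof.
  induction 1; [now apply arrow_implies | now intros B A | eapply implies_trans; eassumption].
Qed.

Lemma path_from_1 r : clos_refl_trans base_red arrow r_1 r.
Proof. destruct r; eauto 8 using clos_refl_trans, arrow. Qed.

Lemma path_to_T r : clos_refl_trans base_red arrow r r_T.
Proof. destruct r; eauto 8 using clos_refl_trans, arrow. Qed.

Lemma not_implies r s r' s' : ~ implies (base_le r') (base_le s') ->
  clos_refl_trans base_red arrow r' r -> clos_refl_trans base_red arrow s s' ->
  ~ implies (base_le r) (base_le s).
Proof.
  intros H H1%path_implies H2%path_implies H3. apply H.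
  eapply implies_trans; [exact H1 |]. eapply implies_trans; eassumption.
Qed.

Theorem theorem3p1 :
  ((implies le_1 le_mr /\ implies le_mr le_T) /\
   (implies le_1 le_mf /\ implies le_mf le_ubfb /\
    implies le_ubfb le_cf /\ implies le_cf le_T)) /\
  ((forall r s : base_red,
      implies (base_le r) (base_le s) ->
      clos_refl_trans base_red arrow r s) /\
   (forall (r : base_red) (s : other_red),
      ~ implies (base_le r) (other_le s) /\
      ~ implies (other_le s) (base_le r))).
Proof.
  split; [| split].
  - auto 8 using le_1_mr, le_mr_T, le_1_mf, le_mf_ubfb, le_ubfb_cf, le_cf_T.
  - intros r s H.
    assert (Hpath : clos_refl_trans base_red arrow r s \/
      ~ implies (base_le r) (base_le s)); [clear H | now destruct Hpath].
    (* Each ordered pair is either joined by a path or inherits one of the four basic separations,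
       by strengthening its premise and weakening its conclusion. *)
    destruct r, s; first
      [ left; eauto 8 using clos_refl_trans, arrow; fail
      | right; eapply (not_implies _ _ r_mr r_cf le_mr_not_cf);
          eauto 8 using clos_refl_trans, arrow; fail
      | right; eapply (not_implies _ _ r_mf r_mr le_mf_not_mr);
          eauto 8 using clos_refl_trans, arrow; fail
      | right; eapply (not_implies _ _ r_ubfb r_mf le_ubfb_not_mf);
          eauto 8 using clos_refl_trans, arrow; fail
      | right; eapply (not_implies _ _ r_cf r_ubfb le_cf_not_ubfb);
          eauto 8 using clos_refl_trans, arrow; fail ].
  - intros r s. split; intros H.
    (* It suffices to refute the implication from the strongest of the six; in the other direction,
       that to the weakest, Turing reducibility, with the empty set as oracle. *)
    + assert (H1 : implies le_1 (other_le s)).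
      { eapply implies_trans; [| exact H]. apply (path_implies r_1), path_from_1. }
      destruct s; [now apply le_1_not_g | now apply le_1_not_cor | now apply le_1_not_ii].
    + destruct not_le_T_empty as [D HD]. apply HD.
      apply (path_implies r r_T (path_to_T r)), H, other_le_on_axis.
Qed.
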